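(* Let $n\ge 1$, $1\le M\le n$, $\underline{s}=(s_1,\dots,s_n)\in\mathbb{R}^n$ and $\eta\in Q_{A_n}$. The integral $\int_{P_{A_n}}e^{-\mathrm{tr}(y\eta)}\Delta^{(M)}_{\underline{s}}(y)\,dy$ converges if and only if $s_i>-\frac32$ for all $i\ne M$ and $s_M>-1$. In this case, $$\int_{P_{A_n}}e^{-\mathrm{tr}(y\eta)}\Delta^{(M)}_{\underline{s}}(y)\,dy=\pi^{(n-1)/2}\Bigl\{\prod_{i\ne M}\Gamma\bigl(s_i+\tfrac32\bigr)\Bigr\}\Gamma(s_M+1)\,\delta^{(M)}_{-\underline{s}}(\eta)\,\varphi_{A_n}(\eta).$$ (Here $\pi$ is the number $3.14\ldots$.)
   Context: $G=A_n$ is the path graph $1-2-\cdots-n$ on $V=\{1,\dots,n\}$; $E=\{(i,j): |i-j|\le 1\}$. $Z_G$ is the space of real symmetric $n\times n$ matrices $y$ with $y_{ij}=0$ if $(i,j)\notin E$; $P_{A_n}=P_G$ is the set of positive definite $y\in Z_G$. $I_G$ is the dual space of $Z_G$, realised as the space of incomplete symmetric matrices $\eta=(\eta_{ij})_{(i,j)\in E}$, with $\langle y,\eta\rangle=\mathrm{tr}(y\eta)=\sum_{(i,j)\in E}y_{ij}\eta_{ij}$. $Q_{A_n}=Q_G=\{\eta\in I_G:\langle y,\eta\rangle>0\ \forall y\in\overline{P_G}\setminus\{0\}\}$ (for $n\ge2$: all $2\times2$ blocks $\eta_{\{i,i+1\}}$ are positive definite). $dy=\prod_{(i,j)\in E,\,i\le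 j}dy_{ij}$ is Lebesgue measure on $Z_G$. For $I\subset V$, $y_I$ (resp. $\eta_I$) is the submatrix with rows and columns in $I$; $\{i:j\}=\{i,\dots,j\}$; $|\cdot|$ is the determinant. With the convention $s_0=s_{n+1}=0$, $$\Delta^{(M)}_{\underline{s}}(y)=\prod_{i=1}^{M-1}|y_{\{1:i\}}|^{s_i-s_{i+1}}\;|y|^{s_M}\prod_{i=M+1}^{n}|y_{\{i:n\}}|^{s_i-s_{i-1}},$$ $$\delta^{(M)}_{\underline{s}}(\eta)=\frac{\prod_{i=1}^{M-1}|\eta_{\{i:i+1\}}|^{s_i}\prod_{i=M+1}^{n}|\eta_{\{i-1:i\}}|^{s_i}}{\prod_{i=2}^{M-1}\eta_{ii}^{s_{i-1}}\cdot\eta_{MM}^{s_{M-1}-s_M+s_{M+1}}\cdot\prod_{i=M+1}^{n-1}\eta_{ii}^{s_{i+1}}}.$$ $\varphi_{A_1}(\eta)=\eta^{-1}$, and for $n\ge2$, $\varphi_{A_n}(\eta)=\prod_{i=1}^{n-1}|\eta_{\{i,i+1\}}|^{-3/2}\prod_{i=2}^{n-1}\eta_{ii}$. *)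

(* Defs.v *)
From HB Require Import structures.
From mathcomp Require Import all_boot all_order all_algebra.
From mathcomp Require Import all_classical all_reals all_analysis.
From mathcomp Require Import zify.

Set Implicit Arguments.
Unset Strict Implicit.
Unset Printing Implicit Defensive.

Import Order.TTheory GRing.Theory Num.Theory.
Import numFieldNormedType.Exports.

Local Open Scope classical_set_scope.
Local Open Scope ring_scope.

Section LebesgueTuple.
Context {R : realType}.

Definition cons_pair k (p : R * k.-tuple R) : k.+1.-tuple R :=
  [tuple of p.1 :: p.2].

Lemma measurable_cons_pair k : measurable_fun [set: R * k.-tuple R] (@cons_pair k).
Proof. exact: measurable_cons. Qed.

Lemma behead_cons_pair k (p : R * k.-tuple R) :
  [tuple of behead (cons_pair p)] = p.2 :> k.-tuple R.
Proof. by apply: val_inj. Qed.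

(* Lebesgue measure on R^k, as the k-fold product of the measure on R *)
Fixpoint lebesgue_tuple k : set (k.-tuple R) -> \bar R :=
  match k with
  | 0 => \d_ [tuple]
  | m.+1 => pushforward (lebesgue_measure \x lebesgue_tuple (k := m))%E
              (@cons_pair m)
  end.

Lemma lebesgue_tuple_sigma_finite_measure k :
  exists mu : {sigma_finite_measure set (k.-tuple R) -> \bar R},
    lebesgue_tuple (k := k) = mu.
Proof.
elim: k => [|k [mu IH]].
  by exists (dirac [tuple]).
pose nu : {measure set (k.+1.-tuple R) -> \bar R} :=
  measure_function_pushforward__canonical__measure_function_Measure
    (lebesgue_measure \x mu)%E (@measurable_cons_pair k).
have nu_sf : sigma_finite setT nu.
  have /sigma_finiteP[F [TF ndF Foo]] :=
    sigma_finiteT (@lebesgue_measure R).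
  have /sigma_finiteP[G [TG ndG Goo]] := sigma_finiteT mu.
  pose tl (t : k.+1.-tuple R) : k.-tuple R := [tuple of behead t].
  pose H i := [set t : k.+1.-tuple R | F i (thead t) /\ G i (tl t)].
  have mH i : measurable (H i).
    rewrite (_ : H i = ((fun t => tnth t ord0) @^-1` F i) `&`
                       (tl @^-1` G i)) //.
    apply: measurableI; rewrite -[X in measurable X]setTI.
      by apply: measurable_tnth => //; case: (Foo i).
    by apply: measurable_behead => //; case: (Goo i).
  exists H.
    apply/seteqP; split => // t _.
    have [a _ Fa] : (\bigcup_i F i) (thead t) by rewrite -TF.
    have [b _ Gb] : (\bigcup_i G i) (tl t) by rewrite -TG.
    exists (maxn a b) => //; split.
      by move: Fa; exact/subsetPset/ndF/leq_maxl.
    by move: Gb; exact/subsetPset/ndG/leq_maxr.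
  move=> i; have [mF Fi] := Foo i; have [mG Gi] := Goo i.
  split; first exact: mH.
  rewrite /nu /= /pushforward /=.
  rewrite (_ : _ @^-1` _ = F i `*` G i); last first.
    by apply/seteqP; split => -[x t] /=; rewrite /H /tl /= theadE behead_cons_pair.
  by rewrite product_measure1E// lte_mul_pinfty// ge0_fin_numE.
pose S := Measure_isSigmaFinite.Build _ _ _ nu nu_sf.
pose nu' : {sigma_finite_measure set (k.+1.-tuple R) -> \bar R} :=
  HB.pack (Measure.sort nu) S.
by exists nu'; rewrite /= IH.
Qed.

Section instance.
Variable k : nat.
Notation mu := (lebesgue_tuple (k := k)).

Let mu0 : mu set0 = 0%E.
Proof.
by have [nu ->] := lebesgue_tuple_sigma_finite_measure k; rewrite measure0.
Qed.
Let mu_ge0 A : (0 <= mu A)%E.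
Proof. by have [nu ->] := lebesgue_tuple_sigma_finite_measure k. Qed.
Let mu_sigma_additive : semi_sigma_additive mu.
Proof.
have [nu ->] := lebesgue_tuple_sigma_finite_measure k.
exact: measure_semi_sigma_additive.
Qed.
HB.instance Definition _ := isMeasure.Build _ _ _ mu
  mu0 mu_ge0 mu_sigma_additive.

Let mu_sigma_finite : sigma_finite setT mu.
Proof.
have [nu ->] := lebesgue_tuple_sigma_finite_measure k.
exact: sigma_finiteT.
Qed.
HB.instance Definition _ := Measure_isSigmaFinite.Build _ _ _ mu mu_sigma_finite.
End instance.

End LebesgueTuple.

Section PathGraph.
Context {R : realType}.
Implicit Types (n M : nat).

Definition Gamma (a : R) : R :=
  (\int[lebesgue_measure]_(x in `]0, +oo[) (x `^ (a - 1) * expR (- x)))%R.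

(* The vertex labelled i in {1, ..., n} is the ordinal of value i - 1.
   [at1 f i] is f at the vertex labelled i, and 0 if i is not a label, so that
   s_0 = s_{n+1} = 0. *)
Definition at1 n (f : 'I_n -> R) (i : nat) : R :=
  if i is k.+1 then oapp f 0 (insub k) else 0.

(* {i:j} = {i, ..., j}, in terms of labels *)
Definition label_itv n (i j : nat) : {set 'I_n} :=
  [set k : 'I_n | (i <= k.+1 <= j)%N].

(* A_I; ordinals are enumerated in increasing order *)
Definition principal_submx n (I : {set 'I_n}) (A : 'M[R]_n) : 'M[R]_#|I| :=
  mxsub (@enum_val _ (mem I)) (@enum_val _ (mem I)) A.

(* E, which contains the loops *)
Definition path_edge n (i j : 'I_n) : bool := (i <= j.+1)%N && (j <= i.+1)%N.

Definition ZG n : set 'M[R]_n :=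
  [set y | y^T = y /\ forall i j, ~~ path_edge i j -> y i j = 0].

Definition posdef n (y : 'M[R]_n) : Prop :=
  y^T = y /\ forall x : 'cV[R]_n, x != 0 -> 0 < (x^T *m y *m x) 0 0.

Definition PG n : set 'M[R]_n := [set y | ZG y /\ posdef y].

(* An incomplete symmetric matrix is represented by any matrix having the
   prescribed entries on E; the entries outside E are arbitrary, and none of
   the definitions below depends on them. *)
Definition IG n : set 'M[R]_n :=
  [set eta | forall i j, path_edge i j -> eta i j = eta j i].

Definition pairing n (y eta : 'M[R]_n) : R :=
  \sum_(i < n) \sum_(j < n | path_edge i j) y i j * eta i j.

Definition QG n : set 'M[R]_n :=
  [set eta | IG eta /\
     forall y, closure (@PG n) y -> y <> 0 -> 0 < pairing y eta].

(* Coordinates on ZG: the entries y_11, y_12, y_22, y_23, ..., y_nn, that is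
   the y_ij with (i,j) in E and i <= j; for 0-based i, j adjacent or equal,
   y_ij is the coordinate of rank i + j. *)
Definition ZG_mx n (t : n.*2.-1.-tuple R) : 'M[R]_n :=
  \matrix_(i, j) if path_edge i j then t`_(i + j) else 0.

Lemma ZG_mxP n : set_bij setT (@ZG n) (@ZG_mx n).
Proof.
have halves k : (k./2 + uphalf k = k)%N.
  by rewrite uphalf_half addnCA addnn odd_double_half.
split.
- move=> t _; split; last by move=> i j /negbTE ij; rewrite mxE ij.
  by apply/matrixP => i j; rewrite !mxE /path_edge andbC addnC.
- move=> t u _ _ tu; apply: eq_from_tnth => k; have := ltn_ord k => kn.
  have an : (k./2 < n)%N by lia.
  have bn : (uphalf k < n)%N by lia.
  have /matrixP/(_ (Ordinal an) (Ordinal bn)) := tu.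
  have edge : (k./2 <= (uphalf k).+1)%N && (uphalf k <= k./2.+1)%N.
    by apply/andP; split; lia.
  rewrite !mxE /path_edge /= edge.
  by rewrite halves !(tnth_nth 0).
- move=> y [ysym yE].
  pose f (k : nat) : R := at1 (fun i => at1 (y i) (uphalf k).+1) (k./2).+1.
  have fE (a b : 'I_n) : (a <= b)%N -> path_edge a b -> f (a + b)%N = y a b.
    move=> ab /andP[_ ba]; rewrite /f.
    have -> : (a + b)./2 = a by lia.
    have -> : uphalf (a + b) = b by lia.
    by rewrite /at1 /= !valK.
  exists [tuple f k | k < n.*2.-1] => //; apply/matrixP => i j.
  rewrite mxE; case: ifPn => [ij|/yE //].
  have ijn : (i + j < n.*2.-1)%N.
    by move: ij (ltn_ord i) (ltn_ord j) => /andP[]; lia.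
  rewrite -(tnth_nth 0 _ (Ordinal ijn)) tnth_mktuple /=.
  have [ltij|ltji] := leqP i j; first exact: fE.
  rewrite addnC fE ?(ltnW ltji)//; last by rewrite /path_edge andbC.
  by rewrite -[in LHS]ysym mxE.
Qed.

(* An integral over P_G with respect to dy is an integral over [PG_coord] with
   respect to Lebesgue measure on R^(2n-1). *)
Definition PG_coord n : set (n.*2.-1.-tuple R) := @ZG_mx n @^-1` @PG n.

Definition Delta n M (s : 'rV[R]_n) (y : 'M[R]_n) : R :=
  (\prod_(1 <= i < M)
     \det (principal_submx (label_itv n 1 i) y)
       `^ (at1 (s 0) i - at1 (s 0) i.+1))
  * (\det y `^ at1 (s 0) M)
  * \prod_(M.+1 <= i < n.+1)
     \det (principal_submx (label_itv n i n) y)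
       `^ (at1 (s 0) i - at1 (s 0) i.-1).

Definition delta n M (s : 'rV[R]_n) (eta : 'M[R]_n) : R :=
  let diag i := at1 (fun k => eta k k) i in
  ((\prod_(1 <= i < M)
      \det (principal_submx (label_itv n i i.+1) eta) `^ at1 (s 0) i)
   * \prod_(M.+1 <= i < n.+1)
      \det (principal_submx (label_itv n i.-1 i) eta) `^ at1 (s 0) i)
  / ((\prod_(2 <= i < M) diag i `^ at1 (s 0) i.-1)
     * diag M `^ (at1 (s 0) M.-1 - at1 (s 0) M + at1 (s 0) M.+1)
     * \prod_(M.+1 <= i < n) diag i `^ at1 (s 0) i.+1).

Definition phi n (eta : 'M[R]_n) : R :=
  let diag i := at1 (fun k => eta k k) i in
  if n == 1%N then (diag 1)^-1
  else (\prod_(1 <= i < n)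
          \det (principal_submx (label_itv n i i.+1) eta) `^ (- (3 / 2)))
       * \prod_(2 <= i < n) diag i.

Definition integrand n M (s : 'rV[R]_n) (eta y : 'M[R]_n) : R :=
  expR (- pairing y eta) * Delta M s y.

End PathGraph.

(* Main.v *)
Require Import Defs.

From HB Require Import structures.
From mathcomp Require Import all_boot all_order all_algebra.
From mathcomp Require Import all_classical all_reals all_analysis.
From mathcomp Require Import measurable_realfun ring lra zify.

(** The two groups of minors in [Delta] are products of pivots. Eliminate the vertices
    [1, ..., M - 1] from the left, each giving a pivot [y_ii - y_{i-1,i}^2 / d_{i-1}],
    then the vertices [n, ..., M + 1] from the right, and [M] last. The minors
    [|y_{1:i}|], [|y_{i:n}|] and [|y|] are the products of the pivots eliminated up to
    that point, the exponents telescope, and [Delta] is the product of the [s_i]-th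
    powers of the pivots ([pivot_densityE]). The matrix [y] is positive definite if and
    only if all pivots are positive ([pivots_gt0P]).

    Replacing the diagonal entries by the pivots is a triangular change of variables
    with Jacobian one; in the iterated integrals it appears as a sequence of translations of
    single coordinates. It turns the trace into a sum of terms that
    couple one pivot [d] with one off-diagonal entry [b]: if [i] is eliminated before
    its neighbour [j], the exponent is
    [- (eta_ii d + 2 eta_ij b + eta_jj b^2 / d)]. The Gaussian integral over [b]
    produces [sqrt (pi d / eta_jj)] and replaces the rate [eta_ii] of the pivot by
    [|eta_{i,j}| / eta_jj]. The remaining integral over [d] is
    a Gamma integral with parameter [s_i + 3/2], the half coming from the
    Gaussian. The vertex [M] has no such edge left and gives parameter [s_M + 1].

    Everything is non-negative, so Tonelli's theorem gives an equality in the extended reals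
    between the integral and a product of one-dimensional integrals
    ([coord_integral_pivot_density]). Membership of [eta] in the dual cone makes all rates
    positive ([diag_entry_gt0], [edge_minor_gt0]). Each factor is then positive, and
    finite exactly when its Gamma parameter is positive, which is the convergence
    criterion ([pivot_integral_lty]); in that case, collecting the powers of the minors and
    diagonal entries of [eta] gives the formula ([pivot_integral_closed]).

    Vertices are numbered from [0] below: [N = n - 1], [m = M - 1], and a matrix of the
    space is given by its coordinates [u], with [u (2 k)] the diagonal entry at [k] and
    [u (2 k + 1)] the entry on the edge [(k, k + 1)]. *)

Set Implicit Arguments.
Unset Strict Implicit.
Unset Printing Implicit Defensive.

Import Order.TTheory GRing.Theory Num.Theory.
Import numFieldNormedType.Exports.

Local Open Scope classical_set_scope.
Local Open Scope ring_scope.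

(** * One-dimensional integrals *)

Section OneDim.
Context {R : realType}.
Local Notation mu := (@lebesgue_measure R).

(** The push-forward of Lebesgue measure by [x |-> k x + d], multiplied by [k],
    agrees with Lebesgue measure on half-open intervals, hence is equal to it.
    This route needs measurability of [f] only: the substitution is later applied
    to functions that jump at [0]. *)
Lemma ge0_integral_affine (k d : R) (f : R -> \bar R) : 0 < k ->
  measurable_fun [set: R] f -> (forall x, (0 <= f x)%E) ->
  (k%:E * \int[mu]_x f (k * x + d)%R = \int[mu]_x f x)%E.
Proof.
move=> k0 mf f0.
pose aff (x : measurableTypeR R) : measurableTypeR R := k * x + d.
have maff : measurable_fun setT aff.
  by apply: measurable_funD => //; exact: measurable_funM.
pose nu : {measure set (measurableTypeR R) -> \bar R} :=
  mscale (NngNum (ltW k0))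
    (measure_function_pushforward__canonical__measure_function_Measure mu maff).
have nuE A : measurable A -> nu A = mu A.
  move=> mA; apply/esym/lebesgue_measure_unique => //= _ [[a b]] _ <-.
  rewrite /mscale /= /pushforward.
  rewrite (_ : aff @^-1` _ = `](a - d) / k, (b - d) / k]%classic); last first.
    apply/funext => x; rewrite /= !in_itv/= /aff.
    by rewrite ltr_pdivrMr// ler_pdivlMr// ltrBlDr lerBrDr (mulrC x).
  rewrite !lebesgue_measure_itv/= !lte_fin ltr_pM2r ?invr_gt0// ltrD2r.
  case: ifP => // _; rewrite ?mule0// -!EFinB -EFinM; congr (_%:E).
  by field; rewrite gt_eqF.
transitivity (\int[nu]_x f x)%E; last first.
  apply: eq_measure_integral => A mA _; exact: nuE.
rewrite /nu ge0_integral_mscale//=; congr (_ * _)%E.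
by rewrite ge0_integral_pushforward.
Qed.

Lemma ge0_integral_shift (d : R) (f : R -> \bar R) :
  measurable_fun [set: R] f -> (forall x, (0 <= f x)%E) ->
  (\int[mu]_x f (x + d)%R = \int[mu]_x f x)%E.
Proof.
move=> mf f0; rewrite -(ge0_integral_affine d ltr01 mf f0) mul1e.
by under [in RHS]eq_integral do rewrite mul1r.
Qed.

(** Completing the square turns the integrand into a multiple of the density of a
    normal law of mean [- b / a] and variance [1 / (2 a)]. *)
Lemma integral_gauss_quadratic (a b : R) : 0 < a ->
  (\int[mu]_x (expR (- (a * x ^+ 2 + 2 * b * x)))%:E =
   (Num.sqrt (pi / a) * expR (b ^+ 2 / a))%:E)%E.
Proof.
move=> a0.
pose sg := Num.sqrt (2 * a)^-1.
have sg2 : sg ^+ 2 = (2 * a)^-1 by rewrite sqr_sqrtr// invr_ge0 mulr_ge0// ltW.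
have sg0 : sg != 0 by rewrite sqrtr_eq0 -ltNge invr_gt0 mulr_gt0.
have pkE : normal_peak sg = (Num.sqrt (pi / a))^-1.
  rewrite /normal_peak sg2; congr (Num.sqrt _)^-1; rewrite -mulr_natr.
  by field; rewrite gt_eqF.
have := integral_normal_pdf (- b / a) sg.
rewrite normal_pdfE// => E1.
under eq_integral => x _.
  rewrite (_ : _%:E = (Num.sqrt (pi / a) * expR (b ^+ 2 / a))%:E *
     (normal_peak sg * normal_fun (- b / a) sg x)%:E)%E; last first.
    rewrite -EFinM; congr (_%:E); rewrite pkE /normal_fun sg2.
    rewrite mulrACA divff ?mul1r; last first.
      by rewrite sqrtr_eq0 -ltNge divr_gt0// pi_gt0.
    rewrite -expRD; congr expR; rewrite -mulr_natr; field.
    by rewrite gt_eqF.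
  over.
rewrite ge0_integralZl//=.
- by rewrite E1 mule1.
- apply/measurable_EFinP; rewrite -[X in measurable_fun _ X]normal_pdfE//.
  exact: measurable_normal_pdf.
- move=> x _; rewrite lee_fin mulr_ge0 ?normal_peak_ge0//.
  exact: expR_ge0.
Qed.

(** Extension of the power by [0] to non-positive arguments. Products of such powers
    of pivots vanish off the cone, so that integrals over the cone become
    integrals over the whole space. *)
Definition pos_powR (a x : R) : R := if 0 < x then x `^ a else 0.

Lemma pos_powR_ge0 a x : 0 <= pos_powR a x.
Proof. by rewrite /pos_powR; case: ifP => // _; exact: powR_ge0. Qed.

Lemma pos_powR_gt0 a x : (0 < pos_powR a x) = (0 < x).
Proof. by rewrite /pos_powR; case: ifP => [/powR_gt0 ->//|]; rewrite ltxx. Qed.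

Lemma measurable_pos_powR a : measurable_fun [set: R] (pos_powR a).
Proof.
apply: measurable_fun_ifT => //.
by apply: measurable_fun_ltr => //; exact: measurable_id.
Qed.

(** Left in extended reals so that the same factorisation covers the convergent and
    the divergent cases. *)
Definition gamma_integral (p c : R) : \bar R :=
  (\int[mu]_x (pos_powR (p - 1) x * expR (- (c * x)))%:E)%E.

Let measurable_gamma_density p c : measurable_fun [set: R]
  (fun x => (pos_powR (p - 1) x * expR (- (c * x)))%:E).
Proof.
apply/measurable_EFinP; apply: measurable_funM; first exact: measurable_pos_powR.
by apply: measurableT_comp => //; apply: measurable_funN; exact: measurable_funM.
Qed.

Let gamma_density_ge0 p c x : (0 <= (pos_powR (p - 1) x * expR (- (c * x)))%:E)%E.
Proof. by rewrite lee_fin mulr_ge0 ?expR_ge0 ?pos_powR_ge0. Qed.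

Lemma gamma_integral_ge0 p c : (0 <= gamma_integral p c)%E.
Proof. by apply: integral_ge0 => x _; exact: gamma_density_ge0. Qed.

Lemma gamma_integral_scale (p c : R) : 0 < c ->
  gamma_integral p c = ((c `^ (- p))%:E * gamma_integral p 1)%E.
Proof.
move=> c0; rewrite /gamma_integral -[in RHS](ge0_integral_affine 0 c0)//.
rewrite muleA -EFinM -ge0_integralZl//; last 2 first.
- have maff : measurable_fun [set: R] (fun x : R => c * x + 0).
    by apply: measurable_funD => //; exact: measurable_funM.
  exact: (measurableT_comp (measurable_gamma_density p 1) maff).
- by rewrite lee_fin mulr_ge0 ?powR_ge0// ltW.
apply: eq_integral => x _; rewrite -EFinM mul1r addr0 mulrA; congr (_ * _)%:E.
rewrite /pos_powR pmulr_rgt0//; case: ifPn => [x0|]; last by rewrite mulr0.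
rewrite powRM ?(ltW c0) ?(ltW x0)// mulrA -[X in _ * X * _ * _]powRr1 ?(ltW c0)//.
have c1 : c != 0 by rewrite gt_eqF.
rewrite -!powRD ?c1 ?implybT// (_ : - p + 1 + (p - 1) = 0) ?powRr0 ?mul1r//; lra.
Qed.

Lemma integral_powR_ltr1 (p e : R) : p != 0 -> 0 < e < 1 ->
  (\int[mu]_(x in `[e, 1%R]) (x `^ (p - 1))%:E = ((1 - e `^ p) / p)%:E)%E.
Proof.
move=> p0 /andP[e0 e1].
have cnt a x : 0 < x -> {for x, continuous (fun y : R => y `^ a)}.
  move=> x0; apply: differentiable_continuous; apply/derivable1_diffP.
  by apply: derivable_powR; rewrite in_itv/= x0.
rewrite (@continuous_FTC2 _ (fun x => x `^ (p - 1)) (fun x => p^-1 * x `^ p))//.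
- by rewrite powR1 -EFinB mulr1 mulrBl mul1r mulrC.
- apply: continuous_in_subspaceT => x; rewrite inE/= in_itv/= => /andP[ex _].
  exact/cnt/(lt_le_trans e0).
- split.
  + move=> x; rewrite in_itv/= => /andP[ex _]; apply: derivableM => //.
    by apply: derivable_powR; rewrite in_itv/= (lt_trans e0 ex).
  + apply: cvgM; first exact: cvg_cst.
    exact/cvg_at_right_filter/cnt.
  + apply: cvgM; first exact: cvg_cst.
    exact/cvg_at_left_filter/cnt.
- move=> x; rewrite in_itv/= => /andP[ex _].
  have x0 := lt_trans e0 ex.
  rewrite derive1E deriveM//; last by apply: derivable_powR; rewrite in_itv/= x0.
  rewrite derive_cst scaler0 addr0 -derive1E powR_derive1 ?in_itv/= ?x0//.
  by rewrite /GRing.scale/= mulKf.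
Qed.

Lemma integral_inv_ltr1 (e : R) : 0 < e < 1 ->
  (\int[mu]_(x in `[e, 1%R]) (x^-1)%:E = (- ln e)%:E)%E.
Proof.
move=> /andP[e0 e1].
rewrite (@continuous_FTC2 _ (fun x => x^-1) (@ln R))//.
- by rewrite ln1 sub0e.
- apply: continuous_in_subspaceT => x; rewrite inE/= in_itv/= => /andP[ex _].
  by apply: inv_continuous; rewrite gt_eqF// (lt_le_trans e0).
- split.
  + move=> x; rewrite in_itv/= => /andP[ex _].
    by apply: ex_derive; apply: is_derive1_ln; exact: lt_trans ex.
  + exact/cvg_at_right_filter/continuous_ln.
  + exact/cvg_at_left_filter/continuous_ln.
- move=> x; rewrite in_itv/= => /andP[ex _].
  by rewrite derive1E; have [_ ->] := is_derive1_ln (lt_trans e0 ex).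
Qed.

(** The integrals over [[1/(i+2), 1]] are at most [1 / p] and increase to this one. *)
Lemma integral_powR01_lty (p : R) : 0 < p ->
  (\int[mu]_(x in `]0%R, 1%R]) (x `^ (p - 1))%:E < +oo)%E.
Proof.
move=> p0; pose F (i : nat) : set R := `[i.+2%:R^-1, 1]%classic.
have UF : `]0, 1]%classic = \bigcup_i F i.
  apply/seteqP; split => [x|x [i _]]; rewrite /F/= !in_itv/=; last first.
    by move=> /andP[ix ->]; rewrite andbT (lt_le_trans _ ix)// invr_gt0.
  move=> /andP[x0 x1]; exists (Num.bound x^-1) => //.
  rewrite /F/= in_itv/= x1 andbT invf_ple// ?posrE//.
  rewrite (le_trans (ltW (archi_boundP _))) ?invr_ge0 ?(ltW x0)// ler_nat.
  exact: leq_trans (leqnSn _) (leqnSn _).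
have mpow (D : set R) : measurable_fun D (fun x : R => (x `^ (p - 1))%:E).
  by apply/measurable_EFinP; apply: measurable_funTS.
have : (\int[mu]_(x in F i) (x `^ (p - 1))%:E)%E @[i --> \oo] -->
       (\int[mu]_(x in \bigcup_i F i) (x `^ (p - 1))%:E)%E.
  apply: ge0_nondecreasing_set_cvg_integral => //.
  - move=> i j ij; apply/subsetPset => x; rewrite /F/= !in_itv/= => /andP[ix ->].
    by rewrite andbT (le_trans _ ix)// lef_pV2 ?posrE// ler_nat ltnS ltnS.
  - by move=> i; exact: measurable_itv.
  - by move=> i; exact: mpow.
  - by move=> i x _; rewrite lee_fin powR_ge0.
rewrite -UF => cF; rewrite (@le_lt_trans _ _ (p^-1)%:E)// ?ltry//.
rewrite -(cvg_lim _ cF)//; apply: lime_le; first by apply/cvg_ex; eexists; exact: cF.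
apply: nearW => i.
rewrite integral_powR_ltr1 ?gt_eqF//; last by rewrite invr_gt0 ltr0n invf_lt1// ltr1n.
by rewrite lee_fin ler_pdivrMr// mulVf ?gt_eqF// gerBl powR_ge0.
Qed.

(** [ln y < y] at [y = x / (2 q)]. *)
Lemma powR_le_expR (q x : R) : 0 < q -> 0 < x -> x `^ q <= (2 * q) `^ q * expR (x / 2).
Proof.
move=> q0 x0; have q20 : 0 < 2 * q by rewrite mulr_gt0.
rewrite /powR !gt_eqF// -expRD ler_expR.
have xE : x = 2 * q * (x / (2 * q)) by field; rewrite gt_eqF.
rewrite [in leLHS]xE lnM ?posrE ?divr_gt0// mulrDr lerD2l.
have /ltW := ln_sublinear (divr_gt0 x0 q20).
rewrite -(ler_pM2l q0) => /le_trans; apply.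
by rewrite le_eqVlt; apply/orP; left; apply/eqP; field; rewrite gt_eqF.
Qed.

(** The integrand is dominated by [x `^ (p - 1)] on [`]0, 1]] and by a multiple of the
    exponential density of rate [1/2] beyond [1]. *)
Lemma gamma_integral1_lty (p : R) : 0 < p -> (gamma_integral p 1 < +oo)%E.
Proof.
move=> p0; pose q := `|p - 1| + 1.
have q0 : 0 < q by rewrite ltr_wpDl.
pose C := (2 * q) `^ q.
have hlf : 0 < 2^-1 :> R by rewrite invr_gt0.
pose g x : \bar R := ((fun y : R => (y `^ (p - 1))%:E) \_ `]0%R, 1%R]) x.
pose h x : \bar R := ((2 * C)%:E * (exponential_pdf 2^-1 x)%:E)%E.
have mg : measurable_fun [set: R] g.
  by apply/(measurable_restrictT _ _).1 => //; apply/measurable_EFinP/measurable_funTS.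
have mh : measurable_fun [set: R] h.
  apply: measurable_funeM; apply/measurable_EFinP; exact: measurable_exponential_pdf.
have g0 x : (0 <= g x)%E.
  by rewrite /g patchE; case: ifP => // _; rewrite lee_fin powR_ge0.
have h0 x : (0 <= h x)%E.
  rewrite /h -EFinM lee_fin !mulr_ge0 ?powR_ge0//.
  exact: exponential_pdf_ge0 (ltW hlf) x.
apply: (@le_lt_trans _ _ (\int[mu]_x (g x + h x))%E).
  apply: ge0_le_integral => //.
  - exact: measurable_gamma_density.
  - exact: emeasurable_funD.
  - move=> x _; rewrite mul1r /pos_powR; case: ifPn => [x0|_]; last first.
      by rewrite mul0r adde_ge0.
    rewrite /h exponential_pdfE ?(ltW x0) ?(ltW hlf)//.
    have E0 : (0 <= (2 * C)%:E * (2^-1 * expR (- 2^-1 * x))%:E)%E.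
      by rewrite lee_fin !mulr_ge0 ?powR_ge0 ?expR_ge0.
    have [x1|x1] := leP x 1.
      rewrite /g patchE mem_setE in_itv/= x0 x1/=.
            rewrite -[leLHS]adde0 leeD// lee_fin ler_piMr ?powR_ge0//.
      by rewrite -expR0 ler_expR oppr_le0 ltW.
    rewrite -[leLHS]add0e leeD// lee_fin.
    have -> : 2 * C * (2^-1 * expR (- 2^-1 * x)) = C * expR (x / 2) * expR (- x).
      rewrite -[RHS]mulrA -expRD mulrACA divff// mul1r; congr (_ * expR _); lra.
    rewrite ler_wpM2r ?expR_ge0// (le_trans _ (powR_le_expR q0 x0))//.
    rewrite ler_powR ?ltW// /q; have := ler_norm (p - 1); lra.
rewrite ge0_integralD//= lte_add_pinfty//.
  by rewrite -integral_mkcond integral_powR01_lty.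
rewrite ge0_integralZl//=.
- by rewrite integral_exponential_pdf// mule1 ltry.
- apply/measurable_EFinP; exact: measurable_exponential_pdf.
- by move=> x _; rewrite lee_fin exponential_pdf_ge0 ?ltW.
- by rewrite lee_fin mulr_ge0// powR_ge0.
Qed.

Lemma Gamma_integralE p : 0 < p -> gamma_integral p 1 = (Gamma p)%:E.
Proof.
move=> p0; rewrite /Gamma /Rintegral -[LHS]fineK; last first.
  by rewrite ge0_fin_numE ?gamma_integral_ge0 ?gamma_integral1_lty.
congr (fine _)%:E; rewrite [RHS]integral_mkcond.
apply: eq_integral => x _; rewrite patchE mem_setE in_itv/= andbT /pos_powR mul1r.
by case: ifP; rewrite // mul0r.
Qed.

Lemma gamma_integralE (p c : R) : 0 < p -> 0 < c ->
  gamma_integral p c = (Gamma p * c `^ (- p))%:E.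
Proof.
by move=> p0 c0; rewrite gamma_integral_scale// Gamma_integralE// -EFinM mulrC.
Qed.

Lemma integral_ge_itv (f : R -> \bar R) (g : R -> \bar R) (a b : R) :
  measurable_fun [set: R] f -> (forall x, (0 <= f x)%E) ->
  measurable_fun `[a, b] g -> (forall x, `[a, b]%classic x -> (0 <= g x <= f x)%E) ->
  (\int[mu]_(x in `[a, b]) g x <= \int[mu]_x f x)%E.
Proof.
move=> mf f0 mg gf.
apply: (@le_trans _ _ (\int[mu]_(x in `[a, b]) f x)%E).
  apply: ge0_le_integral => //; first by move=> x /gf/andP[].
  - exact: measurable_funTS.
  - by move=> x /gf/andP[].
exact: ge0_subset_integral.
Qed.

(** For [p <= 0] the integrand is at least [expR (- c) / x] on [`]0, 1]], and the integral
    of [1 / x] over [[e, 1]] is [- ln e], which is unbounded. *)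
Lemma gamma_integral_pinfty (p c : R) : p <= 0 -> 0 < c -> gamma_integral p c = +oo%E.
Proof.
move=> p0 c0; apply/eqyP => A A0.
(* for this e, the lower bound expR (- c) * - ln e is exactly A *)
pose e := expR (- (A * expR c)).
have e01 : 0 < e < 1.
  by rewrite expR_gt0/= -expR0 ltr_expR oppr_lt0 mulr_gt0 ?expR_gt0.
have minv : measurable_fun `[e, 1] (fun x : R => (x^-1)%:E).
  apply/measurable_EFinP; apply: subspace_continuous_measurable_fun => //.
  apply: continuous_in_subspaceT => x; rewrite inE/= in_itv/= => /andP[ex _].
  by apply: inv_continuous; rewrite gt_eqF// (lt_le_trans _ ex)// expR_gt0.
rewrite (_ : A%:E = (\int[mu]_(x in `[e, 1%R]) ((expR (- c))%:E * (x^-1)%:E))%E); last first.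
  rewrite ge0_integralZl//.
  - rewrite integral_inv_ltr1// /e expRK opprK -EFinM mulrCA -expRD addNr expR0.
    by rewrite mulr1.
  - move=> x/=; rewrite in_itv/= => /andP[ex _]; rewrite lee_fin invr_ge0.
    by rewrite (le_trans _ ex)// expR_ge0.
apply: integral_ge_itv => //; first exact: measurable_funeM.
move=> x/=; rewrite in_itv/= => /andP[ex x1].
have x0 : 0 < x by rewrite (lt_le_trans _ ex)// expR_gt0.
rewrite -EFinM !lee_fin mulr_ge0 ?expR_ge0 ?invr_ge0 ?(ltW x0)//= mulrC.
rewrite /pos_powR x0 ler_pM ?expR_ge0 ?invr_ge0 ?(ltW x0)//.
  by rewrite -powR_inv1 ?(ltW x0)// ger_powR ?x0// lerBlDr addNr.
by rewrite ler_expR lerN2 ger_pMr.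
Qed.

(** Positivity of every factor is what makes one divergent factor force the whole
    product to be infinite. *)
Lemma gamma_integral_gt0 (p c : R) : 0 < c -> (0 < gamma_integral p c)%E.
Proof.
move=> c0; pose q := `|p - 1|.
have q0 : 0 <= q by rewrite normr_ge0.
pose K := 2 `^ (- q) * expR (- (c * 2)).
have K0 : 0 < K by rewrite mulr_gt0 ?expR_gt0 ?powR_gt0.
apply: (@lt_le_trans _ _ (\int[mu]_(x in `[1%R, 2%R]) (cst K%:E) x)%E).
  rewrite integral_cst//= lebesgue_measure_itv/= lte_fin ltr1n -EFinD -EFinM lte_fin.
  by rewrite mulr_gt0// (_ : 2 - 1 = 1 :> R)//; lra.
apply: integral_ge_itv => //.
move=> x/=; rewrite in_itv/= => /andP[x1 x2]; rewrite !lee_fin (ltW K0)/=.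
have x0 : 0 < x by rewrite (lt_le_trans _ x1).
rewrite /pos_powR x0 ler_pM ?expR_ge0 ?powR_ge0//; last first.
  by rewrite ler_expR lerN2 ler_pM2l.
apply: (@le_trans _ _ (x `^ (- q))); last first.
  by rewrite ler_powR// lerNl (le_trans (ler_norm _))// normrN.
by rewrite !powRN lef_pV2 ?posrE ?powR_gt0// ge0_ler_powR ?nnegrE// ltW.
Qed.

End OneDim.

(** * Tonelli's theorem in coordinates *)

Section Tonelli.
Context {R : realType}.
Local Notation mu := (@lebesgue_measure R).

Definition seq_cons (x : R) (u : nat -> R) : nat -> R :=
  fun k => if k is k'.+1 then u k' else x.

(** Functions of a tuple are written as functions of an infinite sequence, of which
    the tuple is a prefix: recursion on the coordinates then needs no casts between
    tuple types. Measurability is tested along every family of sequences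
    with measurable coordinates, a property that is stable under the shifts and
    eliminations of coordinates used below. *)
Definition coord_measurable (f : (nat -> R) -> \bar R) : Prop :=
  forall d (T : measurableType d) (u : T -> nat -> R),
    (forall k, measurable_fun [set: T] (u ^~ k)) ->
    measurable_fun [set: T] (fun x => f (u x)).

Definition coord_integral (k : nat) (f : (nat -> R) -> \bar R) : \bar R :=
  (\int[@lebesgue_tuple R k]_t f (nth 0%R t))%E.

Lemma coord_integral_ge0 k f : (forall u, (0 <= f u)%E) ->
  (0 <= coord_integral k f)%E.
Proof. by move=> f0; apply: integral_ge0 => t _; exact: f0. Qed.

Lemma measurable_coord k i :
  measurable_fun [set: k.-tuple R] (fun t : k.-tuple R => nth 0 t i).
Proof.
have [ik|ki] := ltnP i k.
  rewrite (_ : (fun _ => _) = (fun t : k.-tuple R => tnth t (Ordinal ik))).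
    exact: measurable_tnth.
  by apply/funext => t; rewrite (tnth_nth 0).
rewrite (_ : (fun _ => _) = cst 0); first exact: measurable_cst.
by apply/funext => t; rewrite nth_default ?size_tuple.
Qed.

Lemma coord_integral0_cst c : coord_integral 0 (fun=> c) = c.
Proof.
rewrite /coord_integral integral_cst//.
by rewrite /= diracT mule1.
Qed.

Let prod_meas k (f : (nat -> R) -> \bar R) : coord_measurable f ->
  measurable_fun [set: R * k.-tuple R]
    (fun p : R * k.-tuple R => f (seq_cons p.1 (nth 0 p.2))).
Proof.
move=> mf; apply: mf => -[|i] /=; first exact: measurable_fst.
exact: (measurableT_comp (measurable_coord i) measurable_snd).
Qed.

Lemma coord_integralS_prod k f : coord_measurable f -> (forall u, (0 <= f u)%E) ->
  coord_integral k.+1 f =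
  (\int[mu \x @lebesgue_tuple R k]_p f (seq_cons p.1 (nth 0%R p.2)))%E.
Proof.
move=> mf f0.
have mf' : measurable_fun [set: k.+1.-tuple R] (fun t => f (nth 0%R t)).
  by apply: mf => i; exact: measurable_coord.
pose m : {measure set (measurableTypeR R * k.-tuple R) -> \bar R} :=
  (mu \x @lebesgue_tuple R k)%E.
have mc : measurable_fun [set: measurableTypeR R * k.-tuple R] (@cons_pair R k).
  exact: measurable_cons_pair.
have := @ge0_integral_pushforward _ _ _ _ R _ mc m setT _ measurableT mf' (fun t _ => f0 _).
rewrite preimage_setT => H; etransitivity; first exact: H.
by apply: eq_integral => -[x t] _ /=; congr f; apply/funext => -[].
Qed.

Lemma coord_integralS k f : coord_measurable f -> (forall u, (0 <= f u)%E) ->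
  coord_integral k.+1 f =
  (\int[mu]_x coord_integral k (fun u => f (seq_cons x u)))%E.
Proof.
move=> mf f0; rewrite coord_integralS_prod//.
by rewrite fubini_tonelli1//; exact: prod_meas.
Qed.

Lemma coord_integralSr k f : coord_measurable f -> (forall u, (0 <= f u)%E) ->
  coord_integral k.+1 f =
  coord_integral k (fun u => \int[mu]_x f (seq_cons x u))%E.
Proof.
move=> mf f0; rewrite coord_integralS_prod//.
by rewrite fubini_tonelli2//; exact: prod_meas.
Qed.

Lemma coord_integralZl k c f : coord_measurable f -> (forall u, (0 <= f u)%E) ->
  (0 <= c)%E -> (coord_integral k (fun u => c * f u) = c * coord_integral k f)%E.
Proof.
move=> mf f0 c0; rewrite /coord_integral ge0_integralZl//.
by apply: mf => i; exact: measurable_coord.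
Qed.

Lemma coord_measurable_integral f : coord_measurable f -> (forall u, (0 <= f u)%E) ->
  coord_measurable (fun u => \int[mu]_x f (seq_cons x u))%E.
Proof.
move=> mf f0 d T u mu_.
pose g (p : R * T) := f (seq_cons p.1 (u p.2)).
have mg : measurable_fun [set: R * T] g.
  apply: mf => -[|i] /=; first exact: measurable_fst.
  exact: (measurableT_comp (mu_ i) measurable_snd).
exact: (@measurable_fun_fubini_tonelli_G _ _ _ _ R mu g mg (fun p => f0 _)).
Qed.

Lemma coord_measurable_seq_cons f x : coord_measurable f ->
  coord_measurable (fun u => f (seq_cons x u)).
Proof. by move=> mf d T u mu_; apply: mf => -[|i]//=. Qed.

End Tonelli.

(** * Integration over the pivots *)

Section PathIntegral.
Context {R : realType}.
Local Notation mu := (@lebesgue_measure R).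

Definition skip2 (u : nat -> R) : nat -> R := fun k => u k.+2.

(** One step of Gaussian elimination from the top of the matrix: the coordinates of
    the Schur complement of [y_11]. *)
Definition eliminate (u : nat -> R) : nat -> R :=
  fun k => if k is k'.+1 then u k'.+3 else u 2 - u 1 ^+ 2 / u 0.

(** The pivot of the first vertex when the vertices are eliminated from the last one
    up. Here and below [n] counts the vertices after the first one. *)
Fixpoint right_pivot (n : nat) (u : nat -> R) : R :=
  if n is n'.+1 then u 0 - u 1 ^+ 2 / right_pivot n' (skip2 u) else u 0.

Variables (alpha beta s : nat -> R).

(** The density of all the vertices after the first one, together with the exponential
    in the coordinates of the first one; the power of the first pivot is left out, since
    [coord_integral_right] allows an arbitrary function of it. *)
Fixpoint right_weight (n i : nat) (u : nat -> R) : R :=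
  if n is n'.+1 then
    expR (- (alpha i * u 0 + 2 * beta i * u 1))
    * pos_powR (s i.+1) (right_pivot n' (skip2 u))
    * right_weight n' i.+1 (skip2 u)
  else expR (- (alpha i * u 0)).

(** The integrand in terms of pivots: the vertices before the [m]-th are eliminated from
    the top, those after it from the bottom. In the step from the top the
    exponent has a third term because the elimination lowers the next diagonal entry
    by [u 1 ^+ 2 / u 0]. *)
Fixpoint pivot_density (m n i : nat) (u : nat -> R) : R :=
  match m, n with
  | 0, _ => pos_powR (s i) (right_pivot n u) * right_weight n i u
  | m'.+1, n'.+1 =>
      pos_powR (s i) (u 0)
      * expR (- (alpha i * u 0 + 2 * beta i * u 1
                 + alpha i.+1 * (u 1 ^+ 2 / u 0)))
      * pivot_density m' n' i.+1 (eliminate u)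
  | _.+1, 0 => 0
  end.

Lemma right_weight_ge0 n i u : 0 <= right_weight n i u.
Proof.
elim: n i u => [|n IH] i u /=; first exact: expR_ge0.
by rewrite !mulr_ge0 ?expR_ge0 ?pos_powR_ge0.
Qed.

Lemma pivot_density_ge0 m n i u : 0 <= pivot_density m n i u.
Proof.
elim: m n i u => [|m IH] n i u /=.
  by rewrite mulr_ge0 ?pos_powR_ge0 ?right_weight_ge0.
by case: n => // n; rewrite !mulr_ge0 ?expR_ge0 ?pos_powR_ge0.
Qed.

(** [y^-1 = y * (y ^+ 2) `^ (- 1)] for every [y], and powers are measurable. *)
Lemma measurable_funVr d (T : measurableType d) (f : T -> R) :
  measurable_fun [set: T] f -> measurable_fun [set: T] (fun x => (f x)^-1).
Proof.
move=> mf.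
rewrite (_ : (fun _ => _) = (fun x => f x * (f x ^+ 2) `^ (-1))).
  apply: measurable_funM => //.
  apply: (measurableT_comp (measurable_powR _)) => //.
  exact: measurable_funX.
apply/funext => x; rewrite powR_inv1 ?sqr_ge0// expr2 invfM mulrA.
have [->|fx0] := eqVneq (f x) 0; first by rewrite invr0 !mulr0.
by rewrite divff// mul1r.
Qed.

Section Measurability.
Variables (d : measure_display) (T : measurableType d).

Definition coords_measurable (u : T -> nat -> R) : Prop :=
  forall k, measurable_fun [set: T] (u ^~ k).

Lemma skip2_measurable u : coords_measurable u -> coords_measurable (fun x => skip2 (u x)).
Proof. by move=> mu_ k; exact: mu_. Qed.

Let ratio_measurable u i j : coords_measurable u ->
  measurable_fun [set: T] (fun x => u x i ^+ 2 / u x j).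
Proof.
move=> mu_; apply: measurable_funM; first by apply: measurable_funX; exact: mu_.
by apply: measurable_funVr; exact: mu_.
Qed.

Lemma eliminate_measurable u :
  coords_measurable u -> coords_measurable (fun x => eliminate (u x)).
Proof.
move=> mu_ [|k]; last exact: mu_.
by apply: measurable_funB; [exact: mu_|exact: ratio_measurable].
Qed.

Lemma right_pivot_measurable n u : coords_measurable u ->
  measurable_fun [set: T] (fun x => right_pivot n (u x)).
Proof.
elim: n u => [|n IH] u mu_ /=; first exact: mu_.
apply: measurable_funB; first exact: mu_.
apply: measurable_funM; first by apply: measurable_funX; exact: mu_.
by apply: measurable_funVr; apply: (IH (fun x => skip2 (u x))); exact: skip2_measurable.
Qed.

Let linear_measurable a b u : coords_measurable u ->
  measurable_fun [set: T] (fun x => a * u x 0 + 2 * b * u x 1).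
Proof.
by move=> mu_; apply: measurable_funD; apply: measurable_funM => //; exact: mu_.
Qed.

Lemma right_weight_measurable n i u : coords_measurable u ->
  measurable_fun [set: T] (fun x => right_weight n i (u x)).
Proof.
elim: n i u => [|n IH] i u mu_ /=.
  apply: measurableT_comp => //; apply: measurable_funN.
  by apply: measurable_funM => //; exact: mu_.
apply: measurable_funM; last first.
  by apply: (IH _ (fun x => skip2 (u x))); exact: skip2_measurable.
apply: measurable_funM.
  by apply: measurableT_comp => //; apply: measurable_funN; exact: linear_measurable.
apply: (measurableT_comp (measurable_pos_powR _)).
by apply: (right_pivot_measurable n (u := fun x => skip2 (u x))); exact: skip2_measurable.
Qed.

Lemma pivot_density_measurable m n i u : coords_measurable u ->
  measurable_fun [set: T] (fun x => pivot_density m n i (u x)).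
Proof.
elim: m n i u => [|m IH] n i u mu_ /=.
  apply: measurable_funM; last exact: right_weight_measurable.
  apply: (measurableT_comp (measurable_pos_powR _)); exact: right_pivot_measurable.
case: n => [|n]; first exact: measurable_cst.
apply: measurable_funM; last first.
  by apply: (IH _ _ (fun x => eliminate (u x))); exact: eliminate_measurable.
apply: measurable_funM.
  by apply: (measurableT_comp (measurable_pos_powR _)); exact: mu_.
apply: measurableT_comp => //; apply: measurable_funN; apply: measurable_funD.
  exact: linear_measurable.
by apply: measurable_funM => //; exact: ratio_measurable.
Qed.

End Measurability.

Hypothesis alpha_gt0 : forall i, 0 < alpha i.

Let pos_powR_gauss (a b c e : R) : 0 < a ->
  pos_powR c e * (Num.sqrt (pi / (a / e)) * expR (b ^+ 2 / (a / e))) =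
  Num.sqrt (pi / a) * (pos_powR (c + 3 / 2 - 1) e * expR (b ^+ 2 / a * e)).
Proof.
move=> a0; rewrite /pos_powR; case: ifPn => [e0|_]; last by rewrite !(mul0r, mulr0).
have -> : pi / (a / e) = pi / a * e by field; rewrite !gt_eqF.
have -> : b ^+ 2 / (a / e) = b ^+ 2 / a * e by field; rewrite !gt_eqF.
rewrite sqrtrM; last by rewrite divr_ge0 ?pi_ge0// ltW.
have -> : c + 3 / 2 - 1 = c + 2^-1 by lra.
have en0 : e != 0 by rewrite gt_eqF.
rewrite powRD ?en0 ?implybT// powR12_sqrt ?(ltW e0)//.
ring.
Qed.

(** Integration of the off-diagonal entry against the pivot [e] adjacent to it: the
    Gaussian contributes [e `^ (1 / 2)] and an exponential in [e]. For [e <= 0] both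
    sides vanish. *)
Let integral_pivot_gauss (a b c e K : R) : 0 < a -> 0 <= K ->
  (\int[mu]_y (expR (- (a * (y ^+ 2 / e) + 2 * b * y)) * (pos_powR c e * K))%:E)%E =
  (Num.sqrt (pi / a) * (pos_powR (c + 3 / 2 - 1) e * expR (b ^+ 2 / a * e)) * K)%:E.
Proof.
move=> a0 K0; rewrite -pos_powR_gauss//.
have [e0|e0] := ltP 0 e; last first.
  have -> : pos_powR c e = 0 by rewrite /pos_powR ltNge e0.
  by rewrite !mul0r; under eq_integral do rewrite mulr0; rewrite integral0.
under eq_integral => y _.
  rewrite (_ : a * (y ^+ 2 / e) = a / e * y ^+ 2); last by rewrite mulrCA mulrC.
  rewrite mulrC EFinM; over.
rewrite ge0_integralZl//=.
- rewrite integral_gauss_quadratic ?divr_gt0// -EFinM; congr (_%:E); ring.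
- apply/measurable_EFinP; apply: measurableT_comp => //; apply: measurable_funN.
  by apply: measurable_funD => //; apply: measurable_funM => //; exact: measurable_funX.
- by rewrite lee_fin mulr_ge0// pos_powR_ge0.
Qed.

(** The contribution of the edge [(i, i + 1)] when [i + 1] is eliminated before [i]; in
    [left_factor], when [i] is eliminated before [i + 1]. *)
Definition right_factor (i : nat) : \bar R :=
  ((Num.sqrt (pi / alpha i))%:E *
   gamma_integral (s i.+1 + 3 / 2) (alpha i.+1 - beta i ^+ 2 / alpha i))%E.

Definition left_factor (i : nat) : \bar R :=
  ((Num.sqrt (pi / alpha i.+1))%:E *
   gamma_integral (s i + 3 / 2) (alpha i - beta i ^+ 2 / alpha i.+1))%E.

Let mexp (a : R) : measurable_fun [set: R] (fun x : R => (expR (- (a * x)))%:E).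
Proof.
apply/measurable_EFinP; apply: measurableT_comp => //; apply: measurable_funN.
exact: measurable_funM.
Qed.

(** Peeling off the first vertex: translating [u 0] makes the pivot the variable and
    decouples the integral of [phi]; the Gaussian integral in [u 1] then leaves
    a function of the next pivot alone, to which the induction hypothesis applies. That
    is why [phi] has to be arbitrary. *)
Lemma coord_integral_right n i (phi : R -> \bar R) :
  measurable_fun [set: R] phi -> (forall x, (0 <= phi x)%E) ->
  coord_integral n.*2.+1
    (fun u => (phi (right_pivot n u) * (right_weight n i u)%:E)%E) =
  ((\prod_(i <= j < i + n) right_factor j) *
   \int[mu]_x (phi x * (expR (- (alpha i * x)))%:E))%E.
Proof.
elim: n i phi => [|n IH] i phi mphi phi0.
  rewrite addn0 big_geq// mul1e coord_integralSr//=; last 2 first.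
  - move=> d T u mu_; apply: emeasurable_funM => /=.
      exact: (measurableT_comp mphi (mu_ 0)).
    exact: (measurableT_comp (mexp (alpha i)) (mu_ 0)).
  - by move=> u; rewrite mule_ge0 ?lee_fin ?expR_ge0.
  exact: coord_integral0_cst.
pose f u := (phi (right_pivot n.+1 u) * (right_weight n.+1 i u)%:E)%E.
have mf : coord_measurable f.
  move=> d T u mu_; apply: emeasurable_funM.
    by apply: (measurableT_comp mphi); exact: right_pivot_measurable.
  by apply/measurable_EFinP; exact: right_weight_measurable.
have f0 u : (0 <= f u)%E by rewrite /f mule_ge0 ?lee_fin ?right_weight_ge0.
rewrite -/f doubleS coord_integralSr// coord_integralSr//; last 2 first.
- exact: coord_measurable_integral.
- by move=> u; apply: integral_ge0 => x _.
set Phi := (\int[mu]_x (phi x * (expR (- (alpha i * x)))%:E))%E.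
(* the weight that the integration of u 0 and u 1 puts on the next pivot *)
pose phi' e := Num.sqrt (pi / alpha i) *
  (pos_powR (s i.+1 + 3 / 2 - 1) e * expR (beta i ^+ 2 / alpha i * e)).
have Phi0 : (0 <= Phi)%E by apply: integral_ge0 => x _; rewrite mule_ge0 ?lee_fin ?expR_ge0.
have phi'0 e : 0 <= phi' e by rewrite !mulr_ge0 ?sqrtr_ge0 ?pos_powR_ge0 ?expR_ge0.
have mphi' : measurable_fun [set: R] (EFin \o phi').
  apply/measurable_EFinP; apply: measurable_funM => //; apply: measurable_funM.
    exact: measurable_pos_powR.
  by apply: measurableT_comp => //; exact: measurable_funM.
transitivity (coord_integral n.*2.+1
    (fun u => Phi * ((EFin \o phi') (right_pivot n u) * (right_weight n i.+1 u)%:E))%E).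
  congr coord_integral; apply/funext => u.
  set e := right_pivot n u; set K := right_weight n i.+1 u.
  have K0 : 0 <= K by exact: right_weight_ge0.
  transitivity (\int[mu]_y (Phi * (expR (- (alpha i * (y ^+ 2 / e) + 2 * beta i * y))
      * (pos_powR (s i.+1) e * K))%:E))%E.
    apply: eq_integral => y _.
    rewrite /f /=.
    pose psi x := (phi x * (expR (- (alpha i * x)))%:E)%E.
    have mpsi : measurable_fun [set: R] psi by exact: emeasurable_funM.
    have psi0 x : (0 <= psi x)%E by rewrite mule_ge0 ?lee_fin ?expR_ge0.
    rewrite /Phi -/psi -(ge0_integral_shift (- (y ^+ 2 / e)) mpsi psi0).
    rewrite muleC -ge0_integralZl//; last 2 first.
    - have msh : measurable_fun [set: R] (fun x : R => x - y ^+ 2 / e).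
        exact: measurable_funD.
      exact: (measurableT_comp mpsi msh).
    - by rewrite lee_fin !mulr_ge0 ?expR_ge0 ?pos_powR_ge0.
    apply: eq_integral => x _; rewrite -[skip2 _]/u -/e -/K /psi muleCA -EFinM; congr (_ * _%:E)%E.
    rewrite [RHS]mulrC !mulrA -expRD; congr (expR _ * _ * _); ring.
  rewrite ge0_integralZl//.
  - by rewrite integral_pivot_gauss// EFinM.
  - apply/measurable_EFinP; apply: measurable_funM => //; apply: measurableT_comp => //.
    apply: measurable_funN; apply: measurable_funD; apply: measurable_funM => //.
    by apply: measurable_funM => //; exact: measurable_funX.
  - by move=> y _; rewrite lee_fin !mulr_ge0 ?expR_ge0 ?pos_powR_ge0.
rewrite coord_integralZl//; last 2 first.
- move=> d T u mu_; apply: emeasurable_funM.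
    by apply: (measurableT_comp mphi'); exact: right_pivot_measurable.
  by apply/measurable_EFinP; exact: right_weight_measurable.
- by move=> u; rewrite mule_ge0 ?lee_fin ?right_weight_ge0.
rewrite (IH i.+1 (EFin \o phi'))//.
rewrite addSnnS [in RHS]big_ltn; last by rewrite -addSnnS leq_addr.
rewrite muleC; congr (_ * _)%E.
rewrite muleC; congr (_ * _)%E.
rewrite /right_factor /gamma_integral -ge0_integralZl//.
- apply: eq_integral => x _; rewrite -!EFinM; congr (_%:E).
  rewrite /phi' -!mulrA -expRD; congr (_ * (_ * expR _)); ring.
- apply/measurable_EFinP; apply: measurable_funM; first exact: measurable_pos_powR.
  by apply/measurable_EFinP; exact: mexp.
- by move=> x _; rewrite lee_fin mulr_ge0 ?expR_ge0 ?pos_powR_ge0.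
Qed.

(** Once [u 0] and [u 1] are fixed, [eliminate] is a translation of [u 2]. *)
Lemma coord_integral_eliminate k f a b : coord_measurable f ->
  (forall u, (0 <= f u)%E) ->
  coord_integral k.+1 (fun u => f (eliminate (seq_cons a (seq_cons b u)))) =
  coord_integral k.+1 f.
Proof.
move=> mf f0.
have elimE x v : eliminate (seq_cons a (seq_cons b (seq_cons x v))) =
    seq_cons (x - b ^+ 2 / a) v by apply/funext => -[|].
rewrite (coord_integralSr _ mf f0) coord_integralSr; last 2 first.
- move=> d T u mu_; apply: mf; apply: eliminate_measurable => -[|[|j]] /=.
  + exact: measurable_cst.
  + exact: measurable_cst.
  + exact: mu_.
- by move=> u; exact: f0.
congr coord_integral; apply/funext => v.
have mg : measurable_fun [set: R] (fun x => f (seq_cons x v)).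
  by apply: mf => -[|j]//=; exact: measurable_id.
rewrite -(ge0_integral_shift (- (b ^+ 2 / a)) mg)//.
Qed.

(** For the vertices eliminated from the top the first two coordinates are integrated
    last; by translation invariance the integral over the others does not depend
    on them. *)
Lemma coord_integral_pivot_density m n i : (m <= n)%N ->
  coord_integral n.*2.+1 (fun u => (pivot_density m n i u)%:E) =
  ((\prod_(i <= j < i + m) left_factor j)
   * (\prod_(i + m <= j < i + n) right_factor j)
   * gamma_integral (s (i + m) + 1) (alpha (i + m)))%E.
Proof.
elim: m n i => [|m IH] n i mn.
  rewrite addn0 [X in (X * _ * _)%E]big_geq// mul1e.
  transitivity (coord_integral n.*2.+1 (fun u =>
      (EFin \o pos_powR (s i)) (right_pivot n u) * (right_weight n i u)%:E)%E) => //.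
  rewrite (@coord_integral_right n i (EFin \o pos_powR (s i))); last 2 first.
  - by apply/measurable_EFinP; exact: measurable_pos_powR.
  - by move=> x; rewrite lee_fin pos_powR_ge0.
  by congr (_ * _)%E; rewrite /gamma_integral addrK.
case: n mn => // n mn.
pose g x y := pos_powR (s i) x
   * expR (- (alpha i * x + 2 * beta i * y + alpha i.+1 * (y ^+ 2 / x))).
have g0 x y : 0 <= g x y by rewrite mulr_ge0 ?pos_powR_ge0 ?expR_ge0.
pose f u := (pivot_density m.+1 n.+1 i u)%:E.
have mpd m' n' i' : coord_measurable (fun u => (pivot_density m' n' i' u)%:E).
  by move=> d T u mu_; apply/measurable_EFinP; exact: pivot_density_measurable.
have pd0 m' n' i' u : (0 <= (pivot_density m' n' i' u)%:E)%E.
  by rewrite lee_fin pivot_density_ge0.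
rewrite doubleS (coord_integralS _ (mpd _ _ _) (pd0 _ _ _)).
set J := coord_integral n.*2.+1 (fun u => (pivot_density m n i.+1 u)%:E).
have J0 : (0 <= J)%E by exact: coord_integral_ge0.
transitivity (\int[mu]_x (J * \int[mu]_y (g x y)%:E))%E.
  apply: eq_integral => x _; rewrite coord_integralS; last 2 first.
  - exact: (coord_measurable_seq_cons x (mpd m.+1 n.+1 i)).
  - by [].
  have mgx : measurable_fun [set: R] (fun y => (g x y)%:E).
    apply/measurable_EFinP; apply: measurable_funM => //.
    apply: measurableT_comp => //; apply: measurable_funN; apply: measurable_funD.
      by apply: measurable_funD => //; exact: measurable_funM.
    apply: measurable_funM => //; apply: measurable_funM => //.
  rewrite -ge0_integralZl//; last by move=> y _; rewrite lee_fin.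
  apply: eq_integral => y _; rewrite muleC /J.
  rewrite -(coord_integral_eliminate n.*2 x y (mpd m n i.+1) (pd0 m n i.+1)).
  rewrite -coord_integralZl//; last by rewrite lee_fin.
  move=> d T u mu_; apply: mpd; apply: eliminate_measurable => -[|[|j]] /=.
  + exact: measurable_cst.
  + exact: measurable_cst.
  + exact: mu_.
have gE x : (\int[mu]_y (g x y)%:E = (Num.sqrt (pi / alpha i.+1))%:E *
    (pos_powR (s i + 3 / 2 - 1) x
       * expR (- ((alpha i - beta i ^+ 2 / alpha i.+1) * x)))%:E)%E.
  transitivity (\int[mu]_y (expR (- (alpha i.+1 * (y ^+ 2 / x) + 2 * beta i * y)) *
      (pos_powR (s i) x * expR (- (alpha i * x))))%:E)%E.
    apply: eq_integral => y _; congr (_%:E).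
    rewrite /g [RHS]mulrCA -expRD; congr (_ * expR _); ring.
  rewrite integral_pivot_gauss ?expR_ge0// -EFinM; congr (_%:E).
  rewrite -!mulrA -expRD; congr (_ * (_ * expR _)); ring.
under eq_integral do rewrite gE.
have mG : measurable_fun [set: R] (fun x => (pos_powR (s i + 3 / 2 - 1) x
    * expR (- ((alpha i - beta i ^+ 2 / alpha i.+1) * x)))%:E).
  apply/measurable_EFinP; apply: measurable_funM; first exact: measurable_pos_powR.
  by apply/measurable_EFinP; exact: mexp.
have G0 x : (0 <= (pos_powR (s i + 3 / 2 - 1) x
    * expR (- ((alpha i - beta i ^+ 2 / alpha i.+1) * x)))%:E)%E.
  by rewrite lee_fin mulr_ge0 ?expR_ge0 ?pos_powR_ge0.
rewrite ge0_integralZl//; last 2 first.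
- exact: measurable_funeM.
- by move=> x _; rewrite mule_ge0.
rewrite ge0_integralZl//.
rewrite -/(gamma_integral _ _) -/(left_factor i) /J IH//.
rewrite !addSnnS [in RHS]big_ltn; last by rewrite -addSnnS leq_addr.
by rewrite [LHS]muleC !muleA.
Qed.

End PathIntegral.

(** * Positivity and pivots *)

Section PathMatrix.
Context {R : realType}.
Implicit Types (u x : nat -> R) (n m k : nat).

Definition shift1 x : nat -> R := fun k => x k.+1.

Fixpoint qform n u x : R :=
  if n is n'.+1 then
    u 0 * x 0 ^+ 2 + 2 * u 1 * x 0 * x 1 + qform n' (skip2 u) (shift1 x)
  else u 0 * x 0 ^+ 2.

Definition qform_posdef n u : Prop :=
  forall x, (exists2 k, (k <= n)%N & x k != 0) -> 0 < qform n u x.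

Fixpoint right_pivots_gt0 n u : bool :=
  (0 < right_pivot n u) &&
  (if n is n'.+1 then right_pivots_gt0 n' (skip2 u) else true).

Definition tail_pivots_gt0 n u : bool :=
  if n is n'.+1 then right_pivots_gt0 n' (skip2 u) else true.

Lemma right_pivots_gt0E n u :
  right_pivots_gt0 n u = (0 < right_pivot n u) && tail_pivots_gt0 n u.
Proof. by case: n. Qed.

Fixpoint pivots_gt0 m n u : bool :=
  match m, n with
  | 0, _ => right_pivots_gt0 n u
  | m'.+1, n'.+1 => (0 < u 0) && pivots_gt0 m' n' (eliminate u)
  | _.+1, 0 => false
  end.

(** The last pivot is the minimum of the form when the first coordinate is [1]:
    completing the square in the second coordinate reduces to the smaller form. *)
Lemma qform_ge_right_pivot n u x : right_pivots_gt0 n u ->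
  right_pivot n u * x 0 ^+ 2 <= qform n u x.
Proof.
elim: n u x => [|n IH] u x //= /andP[_ pu].
have e0 : 0 < right_pivot n (skip2 u) by case: n pu {IH} => [|n] /= /andP[].
have := IH _ (shift1 x) pu; rewrite {1}/shift1.
set e := right_pivot n (skip2 u) in e0 *; set q := qform _ _ _ => eq.
have : 0 <= e * (x 1 + u 1 * x 0 / e) ^+ 2 by rewrite mulr_ge0 ?sqr_ge0 ?ltW.
have -> : e * (x 1 + u 1 * x 0 / e) ^+ 2 =
  e * x 1 ^+ 2 + 2 * u 1 * x 0 * x 1 + u 1 ^+ 2 / e * x 0 ^+ 2.
  by field; rewrite gt_eqF.
rewrite mulrBl; lra.
Qed.

(** The minimum is attained. The pivot itself may be non-positive: this is what
    shows that a positive definite form has a positive pivot. *)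
Lemma qform_right_pivot n u c :
  tail_pivots_gt0 n u ->
  exists2 x, x 0 = c & qform n u x = right_pivot n u * c ^+ 2.
Proof.
elim: n u c => [|n IH] u c pu /=; first by exists (fun=> c).
have e0 : 0 < right_pivot n (skip2 u) by case: n pu {IH} => [|n] /= /andP[].
set e := right_pivot n (skip2 u) in e0 *.
(* the second coordinate that cancels the square *)
have [|x x0 qx] := IH (skip2 u) (- u 1 * c / e).
  by case: n pu {IH e e0} => [|n] //= /andP[].
exists (seq_cons c x) => //=.
rewrite -[shift1 _]/x qx x0 -/e; field; rewrite gt_eqF//.
Qed.

Lemma right_pivots_gt0P n u : right_pivots_gt0 n u <-> qform_posdef n u.
Proof.
elim: n u => [|n IH] u.
  rewrite /= andbT; split => [u0 x [[|k]]// _ x0|/(_ (fun=> 1))].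
    by rewrite /= mulr_gt0// exprn_even_gt0.
  by rewrite /= expr1n mulr1; apply; exists 0%N => //; exact: oner_neq0.
split => [pu x [k kn xk]|pu].
  have [x0|x0] := eqVneq (x 0) 0.
    have /andP[_ /IH] := pu; rewrite /= x0 expr0n /= !(mulr0, mul0r) !add0r; apply.
    case: k kn xk => [|k] kn xk; first by rewrite x0 eqxx in xk.
    by exists k.
  apply: lt_le_trans (qform_ge_right_pivot x pu).
  by have /andP[p0 _] := pu; rewrite mulr_gt0// exprn_even_gt0.
have pu' : right_pivots_gt0 n (skip2 u).
  apply/IH => x [k kn xk].
  have := pu (seq_cons 0 x); rewrite /= expr0n /= !(mulr0, mul0r) !add0r.
  by apply; exists k.+1.
apply/andP; split => //.
have [x x0 qx] := @qform_right_pivot n.+1 u 1 pu'.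
have := pu x; rewrite qx expr1n mulr1; apply.
by exists 0%N => //; rewrite x0 oner_neq0.
Qed.

Lemma qform_eliminate n u x : u 0 != 0 ->
  qform n.+1 u x = u 0 * (x 0 + u 1 / u 0 * x 1) ^+ 2
                   + qform n (eliminate u) (shift1 x).
Proof.
move=> u0.
have -> : qform n (eliminate u) (shift1 x) =
    qform n (skip2 u) (shift1 x) - u 1 ^+ 2 / u 0 * x 1 ^+ 2.
  by case: n => [|n] /=; rewrite /shift1 /skip2 /eliminate -/skip2; ring.
by rewrite /=; field.
Qed.

(** Sylvester's criterion, for elimination from both ends. *)
Lemma pivots_gt0P m n u : (m <= n)%N -> pivots_gt0 m n u <-> qform_posdef n u.
Proof.
elim: m n u => [|m IH] n u mn; first exact: right_pivots_gt0P.
case: n mn => // n mn; split => [/andP[u0 /(IH _ _ mn) pu] x [k kn xk]|pu].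
  rewrite qform_eliminate ?gt_eqF//.
  have [[j jn xj]|x0] := pselect (exists2 j, (j <= n)%N & shift1 x j != 0).
    apply: ltr_wpDl; first by rewrite mulr_ge0 ?sqr_ge0 ?ltW.
    by apply: pu; exists j.
  have xS j : (j <= n)%N -> x j.+1 = 0.
    by move=> jn; apply/eqP/negPn/negP => xj; apply: x0; exists j.
  have {k kn}xk : x 0 != 0.
    by case: k kn xk => // k kn; rewrite xS ?eqxx.
  have -> : qform n (eliminate u) (shift1 x) = 0.
    elim: n (eliminate u) x xS {pu IH mn x0 xk} => [|n IHn] v x xS /=.
      by rewrite /shift1 xS// expr0n mulr0.
    by rewrite IHn => [|j jn]; rewrite /shift1 ?xS// expr0n /= !(mulr0,mul0r) !addr0.
  by rewrite addr0 mulr_gt0// exprn_even_gt0//= xS// mulr0 addr0.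
have u0 : 0 < u 0.
  have := pu (seq_cons 1 (fun=> 0)).
  have -> : qform n.+1 u (seq_cons 1 (fun=> 0)) = u 0.
    rewrite /= mulr0 addr0 expr1n mulr1 -[RHS]addr0; congr (_ + _).
    rewrite -[shift1 _]/(fun=> 0 : R).
    elim: n (skip2 u) {pu IH mn} => [|n IHn] v /=; first by rewrite expr0n mulr0.
    by rewrite -[shift1 _]/(fun=> 0 : R) IHn expr0n /= !(mulr0,mul0r) !addr0.
  by apply; exists 0%N; rewrite //= oner_neq0.
apply/andP; split => //; apply/(IH _ _ mn) => x [k kn xk].
have := pu (seq_cons (- (u 1 / u 0 * x 0)) x).
rewrite qform_eliminate ?gt_eqF//= addNr expr0n mulr0 add0r; apply.
by exists k.+1.
Qed.

End PathMatrix.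

(** * Principal minors *)

Section PathDeterminant.
Context {R : realType}.
Implicit Types (u : nat -> R) (n m k : nat).

Definition path_mx n u : 'M[R]_n :=
  \matrix_(i, j) if path_edge i j then u (i + j)%N else 0.

Definition path_det n u : R := \det (path_mx n u).

Lemma path_det0 u : path_det 0 u = 1. Proof. exact: det_mx00. Qed.

Lemma path_det1 u : path_det 1 u = u 0.
Proof. by rewrite /path_det det_mx11 mxE. Qed.

(** The three-term recurrence of tridiagonal determinants. *)
Lemma path_detSS n u :
  path_det n.+2 u = u 0 * path_det n.+1 (skip2 u)
                    - u 1 ^+ 2 * path_det n (skip2 (skip2 u)).
Proof.
rewrite {1}/path_det (expand_det_row _ ord0) !big_ord_recl big1 ?addr0; last first.
  by move=> i _; rewrite mxE /path_edge /= mul0r.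
rewrite !mxE /= /cofactor expr0 mul1r /= expr1 mulN1r mulrN.
congr (_ * _ - _).
  congr (\det _); apply/matrixP => i j; rewrite !mxE /= /path_edge /bump /= !ltnS.
  by rewrite /skip2 !add1n addSn addnS.
rewrite (expand_det_col _ ord0) big_ord_recl big1 ?addr0; last first.
  by move=> i _; rewrite !mxE /path_edge /bump /= ?andbF mul0r.
rewrite !mxE /= /cofactor expr0 mul1r mulrA -expr2; congr (_ * _).
congr (\det _); apply/matrixP => i j; rewrite !mxE /= /path_edge /bump /= !ltnS.
by rewrite /skip2 !add1n !addSn !addnS.
Qed.

Lemma path_det_eliminate n u : u 0 != 0 ->
  path_det n.+1 u = u 0 * path_det n (eliminate u).
Proof.
move=> u0; case: n => [|n]; first by rewrite path_det0 path_det1 mulr1.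
rewrite path_detSS; case: n => [|n].
  by rewrite !path_det1 path_det0 /eliminate /skip2 /=; field.
rewrite !path_detSS [skip2 (eliminate u)](_ : _ = skip2 (skip2 u))//.
rewrite -[skip2 u 0]/(u 2) -[skip2 u 1]/(u 3) -[eliminate u 1]/(u 3).
by rewrite -[eliminate u 0]/(u 2 - u 1 ^+ 2 / u 0); field.
Qed.

Lemma path_det_right_pivot n u : tail_pivots_gt0 n u ->
  path_det n.+1 u = right_pivot n u * path_det n (skip2 u).
Proof.
elim: n u => [|n IH] u; first by rewrite path_det0 path_det1 mulr1.
rewrite {1}/tail_pivots_gt0 right_pivots_gt0E => /andP[e0 pu'].
rewrite path_detSS [right_pivot _ _]/= (IH _ pu').
by field; rewrite gt_eqF.
Qed.

Lemma path_det_gt0 n u : right_pivots_gt0 n u -> 0 < path_det n.+1 u.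
Proof.
elim: n u => [|n IH] u; first by rewrite path_det1 => /andP[].
by move=> /andP[p0 pu]; rewrite path_det_right_pivot// mulr_gt0 ?IH.
Qed.

Section Density.
Variables (alpha beta s : nat -> R).

(** The trace pairing in coordinates; an off-diagonal entry occurs twice in the matrix. *)
Fixpoint linear_form n i u : R :=
  if n is n'.+1 then
    alpha i * u 0 + 2 * beta i * u 1 + linear_form n' i.+1 (skip2 u)
  else alpha i * u 0.

Lemma linear_form_eliminate n i u :
  linear_form n i (eliminate u) =
  linear_form n i (skip2 u) - alpha i * (u 1 ^+ 2 / u 0).
Proof. by case: n => [|n] /=; rewrite /eliminate /skip2; ring. Qed.

Lemma pivot_density_gt0 m n i u : (m <= n)%N ->
  (0 < pivot_density alpha beta s m n i u) = pivots_gt0 m n u.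
Proof.
have mulE (a b : R) : 0 <= a -> 0 <= b -> (0 < a * b) = (0 < a) && (0 < b).
  rewrite le_eqVlt => /predU1P[<- _|a0]; first by rewrite mul0r ltxx.
  by rewrite pmulr_rgt0// a0.
elim: m n i u => [|m IH] n i u mn; last first.
  case: n mn => // n mn /=.
  rewrite !mulE ?mulr_ge0 ?expR_ge0 ?pos_powR_ge0 ?pivot_density_ge0//.
  by rewrite expR_gt0 andbT pos_powR_gt0 IH.
rewrite /= mulE ?pos_powR_ge0 ?right_weight_ge0// pos_powR_gt0.
elim: n i u {mn} => [|n IHn] i u /=; first by rewrite expR_gt0.
rewrite !mulE ?mulr_ge0 ?expR_ge0 ?pos_powR_ge0 ?right_weight_ge0//.
by rewrite expR_gt0 pos_powR_gt0/= IHn; congr andb.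
Qed.

Definition trailing_product m n i u : R :=
  \prod_(m.+1 <= k < n.+1)
    path_det (n - k).+1 (iter k skip2 u) `^ (s (i + k) - s (i + k).-1).

Definition leading_product c m i u : R :=
  \prod_(0 <= k < m) (c * path_det k.+1 u) `^ (s (i + k) - s (i + k).+1).

(** The quotient of two consecutive trailing minors is a pivot, so the exponents
    [s (i + k) - s (i + k).-1] telescope to [s] at each pivot. *)
Lemma right_density n i u : right_pivots_gt0 n u ->
  path_det n.+1 u `^ s i * trailing_product 0 n i u * expR (- linear_form n i u) =
  right_pivot n u `^ s i * right_weight alpha beta s n i u.
Proof.
elim: n i u => [|n IH] i u.
  by rewrite /trailing_product big_geq// mulr1 path_det1.
move=> pu0; have /andP[p0 pu] := pu0.
have := IH i.+1 _ pu.
have d0 := path_det_gt0 pu.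
have e0 : 0 < right_pivot n (skip2 u) by case: n pu {IH pu0 p0 d0} => [|n] /andP[].
rewrite /= /pos_powR e0 => E.
rewrite -[X in _ = _ * X]mulrA -E path_det_right_pivot//.
rewrite powRM ?(ltW p0) ?(ltW d0)// opprD expRD.
have -> : trailing_product 0 n.+1 i u =
    path_det n.+1 (skip2 u) `^ (s i.+1 - s i) * trailing_product 0 n i.+1 (skip2 u).
  rewrite /trailing_product big_ltn// subSS subn0 addn1; congr (_ * _).
  rewrite big_add1; apply: eq_bigr => k _.
  by rewrite subSS -iterSr !addSn !addnS.
have d1 : path_det n.+1 (skip2 u) != 0 by rewrite gt_eqF.
have -> : path_det n.+1 (skip2 u) `^ s i.+1 =
    path_det n.+1 (skip2 u) `^ s i * path_det n.+1 (skip2 u) `^ (s i.+1 - s i).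
  by rewrite -powRD ?d1 ?implybT// addrC subrK.
rewrite -/(right_pivot n.+1 u).
ring.
Qed.

(** The leading minors of [u] are [u 0] times those of [eliminate u]. The factor [c] is
    the product of the pivots eliminated earlier, by which the minors of the remaining
    matrix are multiplied in those of the whole. *)
Lemma pivot_densityE c m n i u : 0 < c -> (m <= n)%N -> pivots_gt0 m n u ->
  leading_product c m i u * (c * path_det n.+1 u) `^ s (i + m)
    * trailing_product m n i u * expR (- linear_form n i u) =
  c `^ s i * pivot_density alpha beta s m n i u.
Proof.
elim: m n c i u => [|m IH] n c i u c0 mn pu.
  rewrite /leading_product big_geq// mul1r addn0 powRM ?(ltW c0) ?ltW ?path_det_gt0//.
  rewrite /= /pos_powR.
  have -> : 0 < right_pivot n u by case: n pu {mn} => [|n] /andP[].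
  by rewrite -right_density// !mulrA.
case: n mn pu => // n mn /andP[u0 pu].
have cu0 : 0 < c * u 0 by rewrite mulr_gt0.
have := IH n (c * u 0) i.+1 _ cu0 mn pu.
have -> : leading_product c m.+1 i u =
    (c * u 0) `^ (s i - s i.+1) * leading_product (c * u 0) m i.+1 (eliminate u).
  rewrite /leading_product big_ltn// addn0 path_det1 big_add1; congr (_ * _).
  by apply: eq_bigr => k _; rewrite path_det_eliminate ?gt_eqF// mulrA !addSn !addnS.
rewrite [path_det n.+2 u]path_det_eliminate ?gt_eqF// mulrA.
have -> : trailing_product m.+1 n.+1 i u = trailing_product m n i.+1 (eliminate u).
  rewrite /trailing_product big_add1; apply: eq_big_nat => k /andP[mk _].
  rewrite subSS addSn addnS; congr (path_det _ _ `^ _).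
  rewrite iterSr; case: k mk => // k _; rewrite !iterSr.
  by congr iter; apply/funext.
rewrite /= /pos_powR u0 linear_form_eliminate => E.
have -> : (c * u 0) `^ (s i - s i.+1) = (c * u 0) `^ s i / (c * u 0) `^ s i.+1.
  by rewrite powRB// (gt_eqF cu0) implybT.
rewrite addnS.
set A := leading_product _ _ _ _ in E *; set B := (_ `^ s (_ + _)) in E *.
set T := trailing_product _ _ _ _ in E *.
have -> : expR (- (alpha i * u 0 + 2 * beta i * u 1 + linear_form n i.+1 (skip2 u)))
  = expR (- (linear_form n i.+1 (skip2 u) - alpha i.+1 * (u 1 ^+ 2 / u 0)))
  * expR (- (alpha i * u 0 + 2 * beta i * u 1 + alpha i.+1 * (u 1 ^+ 2 / u 0))).
  by rewrite -expRD; congr expR; ring.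
set P := pivot_density _ _ _ _ _ _ _ in E *.
set e1 := expR _ in E *; set e2 := expR _.
rewrite [in RHS]mulrA [in RHS]mulrA -powRM ?(ltW c0) ?(ltW u0)//.
transitivity ((c * u 0) `^ s i / (c * u 0) `^ s i.+1 * (A * B * T * e1) * e2); first by ring.
rewrite E.
have cn : (c * u 0) `^ s i.+1 != 0 by rewrite gt_eqF// powR_gt0.
by field.
Qed.

End Density.

End PathDeterminant.

(** * Coordinates of the cone *)

Section PathCoordinates.
Context {R : realType}.
Implicit Types (u x : nat -> R) (n m k : nat).

Definition edge_sum n (F : nat -> nat -> R) : R :=
  \sum_(i < n) \sum_(j < n | path_edge i j) F i j.

Lemma edge_sum1 F : edge_sum 1 F = F 0 0.
Proof. by rewrite /edge_sum big_ord1 big_mkcond big_ord1. Qed.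

Lemma edge_sumSS n F :
  edge_sum n.+2 F = F 0 0 + F 0 1 + F 1 0 + edge_sum n.+1 (fun i j => F i.+1 j.+1).
Proof.
rewrite /edge_sum big_ord_recl.
have -> : \sum_(j < n.+2 | path_edge ord0 j) F (@ord0 n.+1) j = F 0 0 + F 0 1.
  rewrite big_mkcond !big_ord_recl big1; last by [].
  by rewrite /= addr0.
rewrite -[RHS]addrA; congr (_ + _).
have rowE (i : 'I_n.+1) : \sum_(j < n.+2 | path_edge (lift ord0 i) j) F (lift ord0 i) j =
    (if i == ord0 then F 1 0 else 0)
    + \sum_(j < n.+1 | path_edge i j) F i.+1 j.+1.
  rewrite big_mkcond big_ord_recl; congr (_ + _).
    by rewrite /path_edge /= andbT -(inj_eq val_inj) /=; case: (nat_of_ord i).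
  by rewrite [RHS]big_mkcond.
under eq_bigr do rewrite rowE.
rewrite big_split /=; congr (_ + _).
by rewrite big_ord_recl big1 //= addr0.
Qed.

Lemma edge_sum_qform n u x :
  edge_sum n.+1 (fun i j => u (i + j)%N * x i * x j) = qform n u x.
Proof.
elim: n u x => [|n IH] u x; first by rewrite edge_sum1 /=; ring.
rewrite edge_sumSS /= -IH.
rewrite (_ : edge_sum _ _ = edge_sum n.+1
   (fun i j => skip2 u (i + j)%N * shift1 x i * shift1 x j)).
  by rewrite addn0 add0n; ring.
by congr edge_sum; apply/funext => i; apply/funext => j; rewrite addSn addnS.
Qed.

Lemma edge_sum_linear_form (alpha beta : nat -> R) (e : nat -> nat -> R) n i u :
  (forall k, (k <= n)%N -> e (i + k)%N (i + k)%N = alpha (i + k)%N) ->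
  (forall k, (k < n)%N -> e (i + k)%N (i + k).+1 = beta (i + k)%N) ->
  (forall k, (k < n)%N -> e (i + k).+1 (i + k)%N = beta (i + k)%N) ->
  edge_sum n.+1 (fun a b => u (a + b)%N * e (i + a)%N (i + b)%N) =
  linear_form alpha beta n i u.
Proof.
elim: n i u => [|n IH] i u ea eb eb'; first by rewrite edge_sum1 (ea 0 isT) !addn0 mulrC.
rewrite edge_sumSS /= -(IH i.+1).
- rewrite (_ : edge_sum _ (fun i0 j => u (i0.+1 + j.+1)%N * _) = edge_sum n.+1
    (fun a b => skip2 u (a + b)%N * e (i.+1 + a)%N (i.+1 + b)%N)).
    have := ea 0 isT; have := eb 0 isT; have := eb' 0 isT.
    by rewrite !addn0 !addn1 => -> -> ->; ring.
  by congr edge_sum; apply/funext => a; apply/funext => b; rewrite !addSn !addnS.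
- by move=> k kn; rewrite addSnnS ea.
- by move=> k kn; rewrite addSnnS eb.
- by move=> k kn; rewrite addSnnS eb'.
Qed.

Lemma path_mx_form n u (x : 'cV[R]_n.+1) (X : nat -> R) :
  (forall i, X (nat_of_ord i) = x i 0) ->
  (x^T *m path_mx n.+1 u *m x) 0 0 = qform n u X.
Proof.
move=> XE; rewrite -edge_sum_qform mxE /edge_sum [RHS](exchange_big_dep xpredT)//=.
apply: eq_bigr => j _; rewrite !mxE big_distrl [RHS]big_mkcond /=.
apply: eq_bigr => i _; rewrite !mxE; case: ifP => _; last by rewrite mulr0 mul0r.
by rewrite !XE (mulrC (x i 0)).
Qed.

Lemma posdef_path_mx n u : posdef (path_mx n.+1 u) <-> qform_posdef n u.
Proof.
split => [[_ pu] x [k kn xk]|pu].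
  pose X : 'cV[R]_n.+1 := \col_i x i.
  rewrite -(@path_mx_form _ _ X); last by move=> i; rewrite mxE.
  apply: pu; apply/eqP => /matrixP/(_ (Ordinal (kn : (k < n.+1)%N)) 0) /eqP.
  by rewrite !mxE /= (negbTE xk).
split; first by apply/matrixP => i j; rewrite !mxE /path_edge andbC addnC.
move=> x x0; rewrite (@path_mx_form _ _ _ (fun k => x (inord k) 0)); last first.
  by move=> i; rewrite inord_val.
apply: pu; have /cV0Pn[i xi] := x0.
by exists i; [rewrite -ltnS ltn_ord | rewrite inord_val].
Qed.

Lemma PG_path_mx n u : PG (path_mx n.+1 u) <-> qform_posdef n u.
Proof.
split=> [[_ /posdef_path_mx]//|/posdef_path_mx pu]; split => //; split.
  by case: pu.
by move=> i j /negbTE ij; rewrite mxE ij.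
Qed.

Lemma PG_coordE m n (t : n.+1.*2.-1.-tuple R) : (m <= n)%N ->
  PG_coord t <-> pivots_gt0 m n (nth 0 t).
Proof. by move=> mn; rewrite pivots_gt0P//; exact: PG_path_mx. Qed.

(** The enumeration of a label interval is an integer interval, so the principal submatrix
    is the block with rows and columns [lo .. lo + p - 1]. *)
Lemma det_principal_submx n (A : 'M[R]_n.+1) lo p : (lo + p <= n.+1)%N ->
  \det (principal_submx (label_itv n.+1 lo.+1 (lo + p)) A) =
  \det (\matrix_(a < p, b < p) A (inord (lo + a)) (inord (lo + b))).
Proof.
move=> lop; set I := label_itv _ _ _.
have enumI : map val (enum I) = iota lo p.
  pose Q k := (lo < k.+1 <= lo + p)%N.
  rewrite /enum_mem -enumT (eq_filter (a2 := preim val Q)); last first.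
    by move=> k; rewrite /= inE.
  rewrite -filter_map val_enum_ord -(subnKC lop) -addnA !iotaD !filter_cat.
  rewrite (eq_in_filter (a2 := pred0)) ?filter_pred0; last first.
    by move=> k; rewrite mem_iota /Q add0n => /andP[_ klo]; rewrite ltnS leqNgt klo.
  rewrite (eq_in_filter (a2 := predT)) ?filter_predT; last first.
    by move=> k; rewrite mem_iota add0n /Q ltnS => ->.
  rewrite (eq_in_filter (a2 := pred0)) ?filter_pred0 ?cats0// => k.
  rewrite mem_iota add0n /Q => /andP[lok _].
  by rewrite [(k < _)%N]ltnNge lok andbF.
have cardI : #|I| = p by rewrite cardE -(size_map val) enumI size_iota.
have fI (k : 'I_#|I|) : nat_of_ord (enum_val k) = (lo + k)%N.
  rewrite /enum_val -(nth_map _ 0%N val) -?cardE// enumI nth_iota// -cardI.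
  exact: ltn_ord.
rewrite /principal_submx; move: (enum_val (A := mem I)) fI.
move: #|I| cardI => q ->.
move=> f fE; congr (\det _); apply/matrixP => a b; rewrite !mxE -!fE.
by rewrite !inord_val.
Qed.

Lemma det_path_principal n u lo p : (lo + p <= n.+1)%N ->
  \det (principal_submx (label_itv n.+1 lo.+1 (lo + p)) (path_mx n.+1 u)) =
  path_det p (iter lo skip2 u).
Proof.
move=> lop; rewrite det_principal_submx//; congr (\det _); apply/matrixP => a b.
rewrite !mxE /path_edge !inordK; last 2 first.
- by rewrite (leq_trans _ lop)// ltn_add2l.
- by rewrite (leq_trans _ lop)// ltn_add2l.
rewrite -!addnS !leq_add2l; case: ifP => // _.
elim: lo {lop} u => [|lo IH] u //; rewrite iterSr -IH /skip2; congr u; lia.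
Qed.

Lemma Delta_path_mx n m (s : 'rV[R]_n.+1) u : (m <= n)%N ->
  Delta m.+1 s (path_mx n.+1 u) =
  leading_product (fun i => at1 (s 0) i.+1) 1 m 0 u
  * path_det n.+1 u `^ at1 (s 0) m.+1
  * trailing_product (fun i => at1 (s 0) i.+1) m n 0 u.
Proof.
move=> mn; rewrite /Delta big_add1 [X in _ * _ * X = _]big_add1 /leading_product /trailing_product /=.
congr (_ * _ * _).
  apply: eq_big_nat => k /andP[_ km]; rewrite mul1r; congr (_ `^ _).
  by rewrite -(add0n k.+1) det_path_principal// add0n (leq_trans km)// ltnW.
apply: eq_big_nat => k /andP[mk kn]; rewrite add0n.
have -> : label_itv n.+1 k.+1 n.+1 = label_itv n.+1 k.+1 (k + (n - k).+1).
  by rewrite addnS subnKC// -ltnS.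
rewrite det_path_principal; last by rewrite addnS subnKC// -ltnS.
by case: k mk kn.
Qed.

End PathCoordinates.

(** * The dual cone *)

Section DualCone.
Context {R : realType}.
Implicit Types (u x : nat -> R) (n m k : nat).

(** The default values [1] and, for [offdiag_entry], [0] keep the positivity of
    [diag_entry_gt0] and [edge_minor_gt0] true at every index. *)
Definition diag_entry n (eta : 'M[R]_n.+1) (i : nat) : R :=
  if (i <= n)%N then eta (inord i) (inord i) else 1.

Definition offdiag_entry n (eta : 'M[R]_n.+1) (i : nat) : R :=
  if (i < n)%N then eta (inord i) (inord i.+1) else 0.

Lemma pairing_path_mx n (eta : 'M[R]_n.+1) u : IG eta ->
  pairing (path_mx n.+1 u) eta =
  linear_form (diag_entry eta) (offdiag_entry eta) n 0 u.
Proof.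
move=> etaI.
rewrite -(@edge_sum_linear_form _ _ _ (fun a b => eta (inord a) (inord b))).
- rewrite /pairing /edge_sum; apply: eq_bigr => i _; apply: eq_bigr => j ij.
  by rewrite mxE ij !add0n !inord_val.
- by move=> k kn; rewrite /diag_entry add0n kn.
- by move=> k kn; rewrite /offdiag_entry add0n kn.
- move=> k kn; rewrite /offdiag_entry add0n kn etaI// /path_edge !inordK ?ltnS//.
    by rewrite leqnn leqW.
  exact: ltnW.
Qed.

(** The coordinates of [v v^T], for [v] equal to [a] at the vertex [p], to [b] at [p + 1]
    and to [0] elsewhere. *)
Definition edge_point p (a b : R) : nat -> R := fun j =>
  if j == p.*2 then a ^+ 2 else if j == p.*2.+1 then a * b
  else if j == p.*2.+2 then b ^+ 2 else 0.

Lemma skip2_edge_point p a b : skip2 (edge_point p.+1 a b) = edge_point p a b.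
Proof. by apply/funext => j; rewrite /skip2 /edge_point doubleS !eqSS. Qed.

Let head_only (c : R) : nat -> R := fun j => if j is 0 then c else 0.

Lemma qform0 n x : qform n (fun=> 0) x = 0.
Proof.
elim: n x => [|n IH] x /=; first by rewrite mul0r.
by rewrite [skip2 _](_ : _ = fun=> 0)// IH !(mulr0, mul0r) !addr0.
Qed.

Let qform_head n c x : qform n (head_only c) x = c * x 0 ^+ 2.
Proof.
case: n => [|n] //=; rewrite [skip2 _](_ : _ = fun=> 0)// qform0.
by rewrite !(mulr0, mul0r) !addr0.
Qed.

Lemma linear_form0 al be n i : linear_form al be n i (fun=> 0) = 0 :> R.
Proof.
elim: n i => [|n IH] i /=; first by rewrite mulr0.
by rewrite [skip2 _](_ : _ = fun=> 0)// IH !mulr0 !addr0.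
Qed.

Let linear_form_head al be n i c : linear_form al be n i (head_only c) = al i * c.
Proof.
case: n => [|n] //=; rewrite [skip2 _](_ : _ = fun=> 0)// linear_form0.
by rewrite !mulr0 !addr0.
Qed.

Let skip2_edge_point0 a b : skip2 (edge_point 0 a b) = head_only (b ^+ 2).
Proof. by apply/funext => -[|j]. Qed.

Lemma qform_edge_point_ge0 n p a b x : (p < n)%N || (p == n) && (b == 0) ->
  0 <= qform n (edge_point p a b) x.
Proof.
elim: p n x => [|p IH] [|n] x //=.
- by move=> _; rewrite /edge_point /= mulr_ge0 ?sqr_ge0.
- move=> _; rewrite skip2_edge_point0 qform_head /edge_point /=.
  rewrite (_ : _ + _ = (a * x 0 + b * x 1) ^+ 2) ?sqr_ge0//.
  by rewrite /shift1; ring.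
- move=> h; rewrite skip2_edge_point /edge_point /= -/(edge_point p a b).
  by rewrite !(mulr0, mul0r) !add0r IH.
Qed.

Lemma linear_form_edge_point al be n p i a b :
  (p < n)%N || (p == n) && (b == 0) ->
  linear_form al be n i (edge_point p a b) =
  al (i + p)%N * a ^+ 2 + 2 * be (i + p)%N * (a * b) + al (i + p).+1 * b ^+ 2.
Proof.
elim: p n i => [|p IH] [|n] i //=.
- by move=> /eqP ->; rewrite /edge_point /= addn0; ring.
- by move=> _; rewrite skip2_edge_point0 linear_form_head /edge_point /= addn0; ring.
- move=> h; rewrite skip2_edge_point IH// /edge_point /=.
  by rewrite !(mulr0, mul0r) !add0r addSnnS.
Qed.

Lemma qformD n u v x : qform n (u \+ v) x = qform n u x + qform n v x.
Proof.
elim: n u v x => [|n IH] u v x /=; first by rewrite mulrDl.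
by rewrite [skip2 _](_ : _ = skip2 u \+ skip2 v)// IH; ring.
Qed.

Definition scalar_point (e : R) : nat -> R := fun j => if odd j then 0 else e.

Let skip2_scalar e : skip2 (scalar_point e) = scalar_point e.
Proof. by apply/funext => j; rewrite /skip2 /scalar_point /= negbK. Qed.

Lemma qform_scalar_ge0 n e x : 0 <= e -> 0 <= qform n (scalar_point e) x.
Proof.
move=> e0; elim: n x => [|n IH] x /=; first by rewrite /scalar_point mulr_ge0 ?sqr_ge0.
rewrite skip2_scalar -[scalar_point e 0]/e -[scalar_point e 1]/(0 : R).
rewrite !(mulr0, mul0r) addr0.
by rewrite addr_ge0// mulr_ge0 ?sqr_ge0.
Qed.

Lemma qform_scalar_posdef n e : 0 < e -> qform_posdef n (scalar_point e).
Proof.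
move=> e0; elim: n => [|n IH] x [k kn xk] /=.
  by case: k kn xk => // _ x0; rewrite /scalar_point/= mulr_gt0// exprn_even_gt0.
rewrite skip2_scalar -[scalar_point e 0]/e -[scalar_point e 1]/(0 : R).
rewrite !(mulr0, mul0r) addr0.
case: k kn xk => [|k] kn xk.
  rewrite ltr_pwDl ?qform_scalar_ge0 ?(ltW e0)//.
  by rewrite mulr_gt0// exprn_even_gt0.
rewrite ltr_wpDl//; first by rewrite mulr_ge0 ?sqr_ge0 ?(ltW e0).
by apply: IH; exists k.
Qed.

(** Adding a small multiple of the identity to a semidefinite matrix gives a positive
    definite one. *)
Lemma closure_PG_path_mx n u : (forall x, 0 <= qform n u x) ->
  closure (@PG R n.+1) (path_mx n.+1 u).
Proof.
move=> u0 B /nbhs_ballP[e /= e0 eB].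
have e20 : 0 < e / 2 by rewrite divr_gt0.
exists (path_mx n.+1 (u \+ scalar_point (e / 2))); split.
  apply/PG_path_mx => x xn; rewrite qformD.
  by rewrite ltr_wpDl//; exact: qform_scalar_posdef.
apply: eB; split=> // i j; rewrite !mxE; case: ifP => _; last exact: ballxx.
rewrite /ball /= opprD addrA subrr sub0r normrN /scalar_point.
by case: ifP => _; rewrite ?normr0// ger0_norm ?(ltW e20)// ltr_pdivrMr// ltr_pMr// ltr1n.
Qed.

Section QGfacts.
Variables (n : nat) (eta : 'M[R]_n.+1).
Hypothesis etaQ : QG eta.

(** The defining inequality of the dual cone, at the rank-one matrix with coordinates
    [edge_point p a b]. *)
Let point_gt0 p a b : (p < n)%N || (p == n) && (b == 0) -> (a != 0) || (b != 0) ->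
  0 < diag_entry eta p * a ^+ 2 + 2 * offdiag_entry eta p * (a * b)
      + diag_entry eta p.+1 * b ^+ 2.
Proof.
move=> pn ab0; have [etaI etaP] := etaQ.
rewrite -[X in diag_entry eta X * a ^+ 2]add0n -[X in offdiag_entry eta X]add0n.
rewrite -[X in diag_entry eta X.+1]add0n -(linear_form_edge_point _ _ 0 a pn).
rewrite -pairing_path_mx//; apply: etaP.
  by apply: closure_PG_path_mx => x; exact: qform_edge_point_ge0.
have pn' : (p <= n)%N by case/orP: pn => [/ltnW//|/andP[/eqP ->]].
move=> /matrixP y0; case/orP: ab0 => [a0|b0].
  have := y0 (inord p) (inord p); rewrite !mxE /path_edge !inordK ?ltnS// leqnSn /=.
  by rewrite /edge_point addnn eqxx => /eqP; rewrite sqrf_eq0 (negbTE a0).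
have {}pn : (p < n)%N by move: pn; rewrite (negbTE b0) andbF orbF.
have := y0 (inord p.+1) (inord p.+1); rewrite !mxE /path_edge !inordK ?ltnS// leqnSn /=.
rewrite /edge_point addnn doubleS eqxx gtn_eqF// gtn_eqF// => /eqP.
by rewrite sqrf_eq0 (negbTE b0).
Qed.

Lemma diag_entry_gt0 i : 0 < diag_entry eta i.
Proof.
have [ilen|nlti] := leqP i n; last by rewrite /diag_entry leqNgt nlti ltr01.
have := @point_gt0 i 1 0; rewrite eqxx andbT orbC -leq_eqVlt ilen oner_neq0.
by rewrite expr1n expr0n mulr1 !mulr0 !addr0; apply.
Qed.

Lemma edge_minor_gt0 i :
  0 < diag_entry eta i * diag_entry eta i.+1 - offdiag_entry eta i ^+ 2.
Proof.
have [ilen|nlti] := ltnP i n; last first.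
  by rewrite /offdiag_entry ltnNge nlti expr0n subr0 mulr_gt0 ?diag_entry_gt0.
have d0 := diag_entry_gt0 i.
(* the vector at which the binary form takes the value diag * minor *)
have := @point_gt0 i (- offdiag_entry eta i) (diag_entry eta i).
rewrite ilen (gt_eqF d0) orbT => /(_ isT isT).
rewrite (_ : _ + _ = diag_entry eta i *
  (diag_entry eta i * diag_entry eta i.+1 - offdiag_entry eta i ^+ 2)).
  by rewrite pmulr_rgt0.
ring.
Qed.

End QGfacts.

End DualCone.

(** * The closed form *)

Section ClosedForm.
Context {R : realType}.

Lemma at1E n (f : 'I_n.+1 -> R) k : (k <= n)%N -> at1 f k.+1 = f (inord k).
Proof.
move=> kn; rewrite /at1 (insubT (fun k => k < n.+1)%N kn) /=.
by congr f; apply: val_inj; rewrite SubK /= inordK.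
Qed.

Lemma at1_out n (f : 'I_n -> R) k : (n <= k)%N -> at1 f k.+1 = 0.
Proof. by move=> nk; rewrite /at1 insubN// -leqNgt. Qed.

Lemma at1N n (s : 'rV[R]_n) i : at1 ((- s) 0) i = - at1 (s 0) i.
Proof. by case: i => [|i] /=; rewrite ?oppr0//; case: insub => [j|] /=; rewrite ?mxE ?oppr0. Qed.

Local Arguments at1 : simpl never.

Lemma gamma_integral_ltyE (p c : R) : 0 < c -> (gamma_integral p c < +oo)%E = (0 < p).
Proof.
move=> c0; have [p0|p0] := ltP 0 p; first by rewrite gamma_integralE// ltry.
by rewrite gamma_integral_pinfty// ltxx.
Qed.

Lemma lty_mulE (x y : \bar R) : (0 < x)%E -> (0 < y)%E ->
  (x * y < +oo)%E = (x < +oo)%E && (y < +oo)%E.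
Proof.
move: x y => [x| |] [y| |]// x0 y0.
- by rewrite -EFinM !ltry.
- by rewrite gt0_muley// ltxx andbF.
- by rewrite gt0_mulye.
Qed.

Lemma prod_gt0_lty (F : nat -> \bar R) k n : (forall i, 0 < F i)%E ->
  (0 < \prod_(k <= i < n) F i)%E /\
  ((\prod_(k <= i < n) F i < +oo)%E <-> forall i, (k <= i < n)%N -> (F i < +oo)%E).
Proof.
move=> F0; have [nk|] := leqP n k.
  rewrite big_geq//; split; first exact: lte01.
  by split=> [_ i /andP[ki]|_]; [rewrite ltnNge (leq_trans nk ki)|exact: ltry].
elim: n => // n IH; rewrite ltnS leq_eqVlt => /predU1P[->|/IH[P0 Plt]].
  rewrite big_nat1; split => //; split=> [Fn i|]; last by apply; rewrite leqnn ltnSn.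
  by rewrite ltnS -eqn_leq => /eqP <-.
have [kn|nk] := leqP k n; last first.
  have nk' : (n.+1 <= k)%N by [].
  rewrite big_geq//; split; first exact: lte01.
  by split=> [_ i /andP[ki]|_]; [rewrite ltnNge (leq_trans nk' ki)|exact: ltry].
rewrite big_nat_recr//=; split; first exact: mule_gt0.
rewrite lty_mulE//; split=> [/andP[/Plt h Fn] i /andP[ki]|h].
  by rewrite ltnS leq_eqVlt => /predU1P[->//|i_n]; apply: h; rewrite ki.
rewrite h ?kn ?ltnSn// andbT; apply/Plt => i /andP[ki i_n]; apply: h.
by rewrite ki ltnW.
Qed.

(** One edge factor in closed form: [d] is the [2 x 2] minor of [eta] on the edge and
    [a] the diagonal entry at the end of the edge that is eliminated last. *)
Lemma gauss_gammaE (a d q : R) : 0 < a -> 0 < d -> 0 < q + 3 / 2 ->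
  ((Num.sqrt (pi / a))%:E * gamma_integral (q + 3 / 2) (d / a))%E =
  (pi `^ 2^-1 * Gamma (q + 3 / 2) * d `^ (- q) * d `^ (- (3 / 2)) * (a `^ q * a))%:E.
Proof.
move=> a0 d0 q0; rewrite gamma_integralE ?divr_gt0// -EFinM; congr (_%:E).
have an : a != 0 by rewrite gt_eqF.
have dn : d != 0 by rewrite gt_eqF.
rewrite -powR12_sqrt ?divr_ge0 ?pi_ge0 ?(ltW a0)//.
rewrite !powRM ?invr_ge0 ?pi_ge0 ?(ltW a0) ?(ltW d0)//.
rewrite -(powR_inv1 (ltW a0)) -!powRrM opprD powRD ?dn ?implybT//.
have <- : a `^ (-1 * 2^-1) * a `^ (-1 * (- q - 3 / 2)) = a `^ q * a.
  rewrite -[X in _ = _ * X](powRr1 (ltW a0)) -!powRD ?an ?implybT//.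
  by congr (_ `^ _); lra.
ring.
Qed.

Variables (N m : nat) (s : 'rV[R]_N.+1) (eta : 'M[R]_N.+1).
Hypotheses (mN : (m <= N)%N) (etaQ : QG eta).

Local Notation a := (diag_entry eta).
Local Notation b := (offdiag_entry eta).
Local Notation sg := (fun i => at1 (s 0) i.+1).
Let D i := a i * a i.+1 - b i ^+ 2.
Let L := at1 (s 0) m.
Let U := at1 (s 0) m.+2.

Let a0 i : 0 < a i. Proof. exact: diag_entry_gt0. Qed.
Let D0 i : 0 < D i. Proof. exact: edge_minor_gt0. Qed.

Let left_rate i : a i - b i ^+ 2 / a i.+1 = D i / a i.+1.
Proof. by rewrite /D; field; rewrite gt_eqF. Qed.

Let right_rate i : a i.+1 - b i ^+ 2 / a i = D i / a i.
Proof. by rewrite /D; field; rewrite gt_eqF. Qed.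

Lemma det_edge_minor i : (i < N)%N ->
  \det (principal_submx (label_itv N.+1 i.+1 i.+2) eta) = D i.
Proof.
move=> iN; rewrite -addn2 det_principal_submx ?addn2//.
rewrite (expand_det_row _ ord0) !big_ord_recl big_ord0 /cofactor !det_mx11 !mxE /=.
rewrite !(addn0, addn1) expr0 expr1 mulN1r mul1r addr0 mulrN.
rewrite /D /diag_entry /offdiag_entry iN (ltnW iN).
have [etaI _] := etaQ.
rewrite [X in _ - _ * X]etaI ?expr2// /path_edge !inordK ?ltnS ?(ltnW iN)//.
by rewrite leqnn leqW.
Qed.

Lemma at1_diag i : (i <= N)%N -> at1 (fun k => eta k k) i.+1 = a i.
Proof. by move=> iN; rewrite at1E// /diag_entry iN. Qed.

Lemma delta_closed : delta m.+1 (- s) eta =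
  (\prod_(0 <= j < m) D j `^ (- sg j)) * (\prod_(m <= j < N) D j `^ (- sg j.+1))
  * ((\prod_(1 <= k < m) a k `^ sg k.-1) * a m `^ (L - sg m + U)
     * \prod_(m.+1 <= k < N) a k `^ sg k.+1).
Proof.
rewrite /delta big_add1 [X in _ * X / _]big_add1 [X in _ * X / _]big_add1 /=.
rewrite [X in _ / (X * _ * _)]big_add1 [X in _ / (_ * X)]big_add1 /=.
rewrite !invfM -!prodfV.
congr (_ * _ * (_ * _ * _)).
- apply: eq_big_nat => k /andP[_ km]; have kN := leq_trans km mN.
  by rewrite det_edge_minor// at1N.
- by apply: eq_big_nat => k /andP[_ kN]; rewrite det_edge_minor// at1N.
- apply: eq_big_nat => k /andP[k1 km]; rewrite at1_diag; last first.
    by rewrite (leq_trans (ltnW km)).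
  by rewrite at1N powRN invrK; case: k k1 {km}.
- by rewrite at1_diag// !at1N -powRN; congr (_ `^ _); rewrite /L /U; lra.
- apply: eq_big_nat => k /andP[k1 kN]; rewrite at1_diag; last exact: ltnW.
  by rewrite at1N powRN invrK.
Qed.

(** The exponent of [a m] is [1] at an inner vertex, [0] at an end of the path and [- 1]
    if [m] is the only vertex, which is the exceptional value of [phi] on one vertex. *)
Lemma phi_closed : phi eta =
  (\prod_(0 <= j < N) D j `^ (- (3 / 2)))
  * ((\prod_(1 <= k < m) a k) * a m `^ ((0 < m)%:R + (m < N)%:R - 1)
     * \prod_(m.+1 <= k < N) a k).
Proof.
rewrite /phi eqSS; case: ifPn => [/eqP N0|N0].
  have m0 : m = 0%N by move: mN; rewrite N0 leqn0 => /eqP.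
  rewrite at1_diag// m0; have -> : (0 < N)%N = false by rewrite N0.
  rewrite !big_geq ?N0// !mul1r mulr1 addr0 sub0r.
  by rewrite powR_inv1 ?(ltW (a0 _)).
rewrite big_add1 [X in _ * X]big_add1 /=; congr (_ * _).
  by apply: eq_big_nat => k /andP[_ kN]; rewrite det_edge_minor.
rewrite (eq_big_nat _ _ (F2 := a)); last first.
  by move=> k /andP[_ kN]; rewrite at1_diag// ltnW.
have an : a m != 0 by rewrite gt_eqF.
case: (posnP m) => [m0|m0].
  have Ngt0 : (0 < N)%N by rewrite lt0n.
  rewrite m0 [X in _ = X * _ * _]big_geq// mul1r Ngt0 /=.
  by rewrite add0r subrr powRr0 mul1r.
have [mltN|] := ltnP m N.
  rewrite (big_cat_nat (n := m)) ?(ltnW mltN)//= [X in _ * X = _]big_ltn// mulrA.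
  by rewrite addrK powRr1// ltW.
move=> Nm; rewrite [X in _ = _ * X]big_geq ?leqW// addr0 subrr powRr0 !mulr1.
by apply: congr_big_nat => //; apply/eqP; rewrite eqn_leq Nm mN.
Qed.

(** The two lemmas below separate the vertex [m] from the others. The booleans record whether
    [m] has a neighbour on that side; if not, [L] or [U] is zero by the convention on
    labels out of range. *)
Lemma left_diag_product :
  \prod_(0 <= j < m) (a j.+1 `^ sg j * a j.+1) =
  (\prod_(1 <= k < m) a k `^ sg k.-1) * (\prod_(1 <= k < m) a k)
  * a m `^ (L + (0 < m)%:R).
Proof.
rewrite -big_split /= /L; case: m => [|k]; first by rewrite !big_geq// addr0 powRr0 mul1r.
rewrite big_nat_recr//= big_add1 /=; congr (_ * _).
have an : a k.+1 != 0 by rewrite gt_eqF.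
by rewrite powRD ?an ?implybT// powRr1// ltW.
Qed.

Lemma right_diag_product :
  \prod_(m <= j < N) (a j `^ sg j.+1 * a j) =
  a m `^ (U + (m < N)%:R)
  * ((\prod_(m.+1 <= k < N) a k `^ sg k.+1) * (\prod_(m.+1 <= k < N) a k)).
Proof.
rewrite -big_split /= /U; have [mltN|Nm] := ltnP m N.
  have am : a m != 0 by rewrite gt_eqF.
  by rewrite big_ltn//= powRD ?am ?implybT// powRr1// ltW.
by rewrite !big_geq ?leqW// at1_out// addr0 powRr0 mul1r.
Qed.

Lemma prod_skip (F : nat -> R) :
  \prod_(1 <= i < N.+2 | i != m.+1) F i =
  (\prod_(0 <= j < m) F j.+1) * \prod_(m <= j < N) F j.+2.
Proof.
rewrite big_add1 (big_cat_nat (n := m))//=; last exact: leqW.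
congr (_ * _).
  rewrite big_nat_cond [RHS]big_nat_cond; apply: eq_bigl => k.
  by case: ltnP => km; rewrite ?andbF//= eqSS neq_ltn km.
rewrite big_ltn_cond ?ltnS// eqSS eqxx /= big_add1 /=.
rewrite big_nat_cond [RHS]big_nat_cond; apply: eq_bigl => k.
by case: (leqP m k) => mk //=; rewrite !eqSS gtn_eqF ?andbT// ltnS.
Qed.

Definition convergent : Prop :=
  [/\ forall j, (j < m)%N -> 0 < sg j + 3 / 2,
      forall j, (m <= j < N)%N -> 0 < sg j.+1 + 3 / 2 & 0 < sg m + 1].

Definition pivot_integral : \bar R :=
  ((\prod_(0 <= j < m) left_factor a b sg j)
   * (\prod_(m <= j < N) right_factor a b sg j) * gamma_integral (sg m + 1) (a m))%E.

(** All factors are positive, so the product is finite if and only if each factor is. *)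
Lemma pivot_integral_lty : (pivot_integral < +oo)%E <-> convergent.
Proof.
have sq c : 0 < c -> (0 < (Num.sqrt (pi / c))%:E :> \bar R)%E.
  by move=> c0; rewrite lte_fin sqrtr_gt0 divr_gt0// pi_gt0.
have l0 j : (0 < left_factor a b sg j)%E.
  by rewrite /left_factor left_rate mule_gt0 ?sq// gamma_integral_gt0// divr_gt0.
have r0 j : (0 < right_factor a b sg j)%E.
  by rewrite /right_factor right_rate mule_gt0 ?sq// gamma_integral_gt0// divr_gt0.
have lE j : (left_factor a b sg j < +oo)%E = (0 < sg j + 3 / 2).
  rewrite /left_factor left_rate lty_mulE ?sq// ?gamma_integral_gt0 ?divr_gt0//.
  by rewrite ltry gamma_integral_ltyE// divr_gt0.
have rE j : (right_factor a b sg j < +oo)%E = (0 < sg j.+1 + 3 / 2).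
  rewrite /right_factor right_rate lty_mulE ?sq// ?gamma_integral_gt0 ?divr_gt0//.
  by rewrite ltry gamma_integral_ltyE// divr_gt0.
have [L0 Lt] := prod_gt0_lty 0 m l0.
have [R0 Rt] := prod_gt0_lty m N r0.
rewrite /pivot_integral !lty_mulE ?mule_gt0 ?gamma_integral_gt0// gamma_integral_ltyE//.
split=> [/andP[/andP[/Lt hl /Rt hr] hm]|[hl hr ->]].
  by split=> // j jm; [rewrite -lE; exact: hl|rewrite -rE; exact: hr].
rewrite andbT; apply/andP; split; first by apply/Lt => j /andP[_ jm]; rewrite lE hl.
by apply/Rt => j jm; rewrite rE hr.
Qed.

Lemma pivot_integral_closed : convergent ->
  pivot_integral = (pi `^ ((N.+1%:R - 1) / 2)
    * (\prod_(1 <= i < N.+2 | i != m.+1) Gamma (at1 (s 0) i + 3 / 2))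
    * Gamma (at1 (s 0) m.+1 + 1) * delta m.+1 (- s) eta * phi eta)%:E.
Proof.
move=> [hl hr hm].
rewrite /pivot_integral.
rewrite (eq_big_nat _ _ (F2 := fun j => (pi `^ 2^-1 * Gamma (sg j + 3 / 2)
   * D j `^ (- sg j) * D j `^ (- (3 / 2)) * (a j.+1 `^ sg j * a j.+1))%:E)); last first.
  by move=> j /andP[_ jm]; rewrite /left_factor left_rate gauss_gammaE// hl.
rewrite (@eq_big_nat _ _ _ m N _ (fun j => (pi `^ 2^-1 * Gamma (sg j.+1 + 3 / 2)
   * D j `^ (- sg j.+1) * D j `^ (- (3 / 2)) * (a j `^ sg j.+1 * a j))%:E)); last first.
  by move=> j jm; rewrite /right_factor right_rate gauss_gammaE// hr.
rewrite !prodEFin gamma_integralE// -!EFinM; congr (_%:E).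
rewrite ![\prod_(_ <= _ < _) (_ * _ * _ * _ * _)]big_split /=.
rewrite ![\prod_(_ <= _ < _) (_ * _ * _ * _)]big_split /=.
rewrite ![\prod_(_ <= _ < _) (_ * _ * D _ `^ _)]big_split /=.
rewrite ![\prod_(_ <= _ < _) (_ * Gamma _)]big_split /=.
rewrite left_diag_product right_diag_product (prod_skip (fun i => Gamma (at1 (s 0) i + 3 / 2))) delta_closed phi_closed.
rewrite !prodr_const_nat subn0.
rewrite [X in _ = _ * (X * _)](big_cat_nat (n := m))//=.
have -> : pi `^ ((N.+1%:R - 1) / 2) = pi `^ 2^-1 ^+ m * pi `^ 2^-1 ^+ (N - m) :> R.
  rewrite -exprD subnKC// -powR_mulrn ?powR_ge0// -powRrM; congr (_ `^ _).
  by rewrite -natr1; field.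
have am : a m != 0 by rewrite gt_eqF.
have aE : a m `^ (L + (0 < m)%:R) * a m `^ (U + (m < N)%:R) * a m `^ (- (sg m + 1)) =
    a m `^ (L - sg m + U) * a m `^ ((0 < m)%:R + (m < N)%:R - 1).
  by rewrite -!powRD ?am ?implybT//; congr (_ `^ _); ring.
set P1 := a m `^ (L - sg m + U) in aE *.
set P2 := a m `^ ((0 < m)%:R + _ - 1) in aE *.
set Q1 := a m `^ (L + _) in aE *.
set Q2 := a m `^ (U + _) in aE *.
set Q3 := a m `^ (- (sg m + 1)) in aE *.
set G := Gamma (at1 (s 0) m.+1 + 1).
have P2n : P2 != 0 by rewrite gt_eqF// powR_gt0.
(* express P1 through the other powers of a m, to leave an identity of fractions *)
have -> : P1 = Q1 * Q2 * Q3 / P2 by rewrite aE mulfK.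
clear aE; clearbody P1 P2 Q1 Q2 Q3 G.
do !move: (\prod_(_ <= _ < _) _) => ?.
by field.
Qed.

Lemma convergentE : convergent <->
  (forall i : nat, (1 <= i <= N.+1)%N -> i != m.+1 -> - (3 / 2) < at1 (s 0) i)
  /\ - 1 < at1 (s 0) m.+1.
Proof.
split=> [[hl hr hm]|[h hm]].
  split; last by move: hm; lra.
  case=> // i; rewrite eqSS ltnS => /andP[_ iN].
  rewrite neq_ltn => /orP[im|mi]; first by have := hl _ im; lra.
  by case: i iN mi => // i iN mi; have := hr i; rewrite -(ltnS m) mi => /(_ iN); lra.
split; last by move: hm; lra.
  move=> j jm; have := h j.+1; rewrite eqSS (ltn_eqF jm) /= ltnS.
  by rewrite (leq_trans (ltnW jm) mN) => /(_ isT isT); lra.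
move=> j /andP[mj jN]; have := h j.+2; rewrite eqSS (gtn_eqF (_ : (m < j.+1)%N))//=.
by rewrite ltnS jN => /(_ isT isT); lra.
Qed.

Notation density u := (pivot_density a b sg m N 0 u).

Lemma integrand_density (u : nat -> R) : pivots_gt0 m N u ->
  integrand m.+1 s eta (path_mx N.+1 u) = density u.
Proof.
move=> pu; have [etaI _] := etaQ.
have := pivot_densityE a b sg 0 ltr01 mN pu.
rewrite powR1 !mul1r add0n => <-.
by rewrite /integrand Delta_path_mx// pairing_path_mx// mulrC.
Qed.

(** Off the cone some pivot is non-positive and the density vanishes. *)
Lemma integrand_restrict :
  (fun t => (integrand m.+1 s eta (ZG_mx t))%:E) \_ (@PG_coord R N.+1) =
  (fun t => (density (nth 0 t))%:E).
Proof.
apply/funext => t; rewrite patchE; case: ifPn => [|/negP tP].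
  by rewrite inE => /(PG_coordE _ mN) pt; rewrite -integrand_density.
congr (_%:E); apply/esym/eqP; rewrite eq_le pivot_density_ge0 andbT leNgt.
by apply/negP; rewrite pivot_density_gt0// => pt; apply: tP; rewrite inE; apply/(PG_coordE _ mN).
Qed.

Let measurable_density :
  measurable_fun [set: N.*2.+1.-tuple R] (fun t => density (nth 0 t)).
Proof. by apply: pivot_density_measurable => k; exact: measurable_coord. Qed.

Lemma measurable_PG_coord : measurable (@PG_coord R N.+1).
Proof.
rewrite (_ : PG_coord (n := N.+1) =
  (fun t : N.*2.+1.-tuple R => density (nth 0 t)) @^-1` `]0, +oo[%classic).
  by rewrite -[X in measurable X]setTI; apply: measurable_density => //; exact: measurable_itv.
apply/seteqP; split=> t /=; rewrite in_itv/= andbT pivot_density_gt0//.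
  by move/(PG_coordE _ mN).
by move=> pt; apply/(PG_coordE _ mN).
Qed.

Lemma integral_density :
  (\int[@lebesgue_tuple R N.+1.*2.-1]_t (density (nth 0%R t))%:E)%E = pivot_integral.
Proof.
have := @coord_integral_pivot_density R a b sg a0 m N 0 mN.
rewrite !add0n; exact.
Qed.

Lemma integrand_integral :
  (\int[@lebesgue_tuple R N.+1.*2.-1]_(t in @PG_coord R N.+1)
      (integrand m.+1 s eta (ZG_mx t))%:E)%E = pivot_integral.
Proof. by rewrite integral_mkcond integrand_restrict integral_density. Qed.

Lemma integrand_integrable :
  (@lebesgue_tuple R N.+1.*2.-1).-integrable (@PG_coord R N.+1)
     (fun t => (integrand m.+1 s eta (ZG_mx t))%:E) <-> convergent.
Proof.
rewrite -pivot_integral_lty -integrand_integral.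
have absE : (\int[@lebesgue_tuple R N.+1.*2.-1]_(t in @PG_coord R N.+1)
      `|(integrand m.+1 s eta (ZG_mx t))%:E|)%E =
   (\int[@lebesgue_tuple R N.+1.*2.-1]_(t in @PG_coord R N.+1)
      (integrand m.+1 s eta (ZG_mx t))%:E)%E.
  apply: eq_integral => t; rewrite inE => /(PG_coordE _ mN) pt.
  by rewrite integrand_density// gee0_abs// lee_fin pivot_density_ge0.
split=> [/integrableP[_]|fin]; first by rewrite absE.
apply/integrableP; split; last by rewrite absE.
apply/(measurable_restrictT _ measurable_PG_coord).
rewrite integrand_restrict; exact/measurable_EFinP.
Qed.

End ClosedForm.

Theorem theorem3 (R : realType) (n M : nat) (hn : (1 <= n)%N)
    (hM : (1 <= M <= n)%N) (s : 'rV[R]_n) (eta : 'M[R]_n) (heta : QG eta) :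
  let conv := (forall i : nat, (1 <= i <= n)%N -> i != M ->
                 - (3 / 2) < at1 (s 0) i) /\ - 1 < at1 (s 0) M in
  ((@lebesgue_tuple R n.*2.-1).-integrable (@PG_coord R n)
     (fun t => (integrand M s eta (ZG_mx t))%:E) <-> conv)
  /\
  (conv ->
   (\int[@lebesgue_tuple R n.*2.-1]_(t in @PG_coord R n)
      (integrand M s eta (ZG_mx t))%:E)%E =
   (pi `^ ((n%:R - 1) / 2)
    * (\prod_(1 <= i < n.+1 | i != M) Gamma (at1 (s 0) i + 3 / 2))
    * Gamma (at1 (s 0) M + 1)
    * delta M (- s) eta * phi eta)%:E).
Proof.
case: n hn hM s eta heta => // N _; case: M => // m mN s eta etaQ conv.
split; first exact: iff_trans (integrand_integrable s mN etaQ) (convergentE s mN).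
by move=> /(convergentE s mN) cv; rewrite integrand_integral// pivot_integral_closed.
Qed.
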